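(* Let $\Psi_{\alpha\beta},\Psi^*_{\alpha\beta},\bar\Psi_{\alpha\beta},\bar\Psi^*_{\alpha\beta}$ ($\alpha,\beta=1,\dots,N$) be the matrix elements of wave functions and adjoint wave functions of the form described in the context, and assume that the bilinear identity $$\sum_{\gamma=1}^N\oint_{C_\infty}\Psi_{\alpha\gamma}(\mathbf s,\mathbf t,\bar{\mathbf t};z)\Psi^*_{\gamma\beta}(\mathbf s',\mathbf t',\bar{\mathbf t}';z)\,dz=\sum_{\gamma=1}^N\oint_{C_\infty}\bar\Psi_{\alpha\gamma}(\mathbf s,\mathbf t,\bar{\mathbf t};z^{-1})\bar\Psi^*_{\gamma\beta}(\mathbf s',\mathbf t',\bar{\mathbf t}';z^{-1})z^{-2}\,dz$$ holds for all $\alpha,\beta$, $\mathbf s,\mathbf s',\mathbf t,\mathbf t',\bar{\mathbf t},\bar{\mathbf t}'$. Then there exists an $N\times N$ matrix-valued function $\bigl(\tau_{\alpha\beta}(\mathbf s,\mathbf t,\bar{\mathbf t})\bigr)_{\alpha,\beta=1,\dots,N}$ whose diagonal elements are all the same, $\tau_{\alpha\alpha}(\mathbf s,\mathbf t,\bar{\mathbf t})=:\tau(\mathbf s,\mathbf t,\bar{\mathbf t})$ for all $\alpha$, and such that for all $\alpha,\beta$ $$\Psi_{\alpha\beta}(\mathbf s,\mathbf t,\bar{\mathbf t};z)=z^{s_\beta+\delta_{\alpha\beta}-1}e^{\xi(\mathbf t_\beta,z)}\frac{\tau_{\alpha\beta}(\mathbf s,\mathbf t-[z^{-1}]_\beta,\bar{\mathbf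 t})}{\tau(\mathbf s,\mathbf t,\bar{\mathbf t})},$$ $$\Psi^*_{\alpha\beta}(\mathbf s,\mathbf t,\bar{\mathbf t};z)=(-1)^{\delta_{\alpha\beta}-1}z^{-s_\alpha+\delta_{\alpha\beta}-1}e^{-\xi(\mathbf t_\alpha,z)}\frac{\tau_{\alpha\beta}(\mathbf s,\mathbf t+[z^{-1}]_\alpha,\bar{\mathbf t})}{\tau(\mathbf s,\mathbf t,\bar{\mathbf t})},$$ $$\bar\Psi_{\alpha\beta}(\mathbf s,\mathbf t,\bar{\mathbf t};z^{-1})=(-1)^{\delta_{\alpha\beta}-1}z^{-s_\beta}e^{\xi(\bar{\mathbf t}_\beta,z)}\frac{\tau_{\alpha\beta}(\mathbf s+[1]_\beta,\mathbf t,\bar{\mathbf t}-[z^{-1}]_\beta)}{\tau(\mathbf s,\mathbf t,\bar{\mathbf t})},$$ $$\bar\Psi^*_{\alpha\beta}(\mathbf s,\mathbf t,\bar{\mathbf t};z^{-1})=z^{s_\alpha}e^{-\xi(\bar{\mathbf t}_\alpha,z)}\frac{\tau_{\alpha\beta}(\mathbf s-[1]_\alpha,\mathbf t,\bar{\mathbf t}+[z^{-1}]_\alpha)}{\tau(\mathbf s,\mathbf t,\bar{\mathbf t})}.$$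
   Context: Fix $N\ge1$. Variables: $\mathbf s=(s_1,\dots,s_N)\in\mathbb Z^N$, $\mathbf t=(t_{\alpha,k})$ and $\bar{\mathbf t}=(\bar t_{\alpha,k})$ with $1\le\alpha\le N$, $k\ge1$; $\mathbf t_\alpha=(t_{\alpha,k})_{k\ge1}$, $\bar{\mathbf t}_\alpha=(\bar t_{\alpha,k})_{k\ge1}$. $\xi(\mathbf t_\alpha,z)=\sum_{k\ge1}t_{\alpha,k}z^k$. $\mathbf t\pm[z^{-1}]_\gamma$ is $\mathbf t$ with $t_{\alpha,j}$ replaced by $t_{\alpha,j}\pm\delta_{\alpha\gamma}z^{-j}/j$ (same for $\bar{\mathbf t}$). $\mathbf s\pm[1]_\alpha$ is $\mathbf s$ with $s_\alpha$ replaced by $s_\alpha\pm1$. Form of the wave functions: $\Psi_{\alpha\beta}(\mathbf s,\mathbf t,\bar{\mathbf t};z)=z^{s_\beta}e^{\xi(\mathbf t_\beta,z)}w_{\alpha\beta}(\mathbf s,\mathbf t,\bar{\mathbf t};z)$, $w_{\alpha\beta}(z)=\sum_{j\ge0}w_{j,\alpha\beta}z^{-j}$; $\Psi^*_{\alpha\beta}(\mathbf s,\mathbf t,\bar{\mathbf t};z)=z^{-s_\alpha}e^{-\xi(\mathbf t_\alpha,z)}w^*_{\alpha\beta}(\mathbf s,\mathbf t,\bar{\mathbf t};z)$, $w^*_{\alpha\beta}(z)=\sum_{j\ge0}w^*_{j,\alpha\beta}z^{-j}$; $\bar\Psi_{\alpha\beta}(\mathbf s,\mathbf t,\bar{\mathbf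 t};z)=z^{s_\beta}e^{\xi(\bar{\mathbf t}_\beta,z^{-1})}\bar w_{\alpha\beta}(\mathbf s,\mathbf t,\bar{\mathbf t};z)$, $\bar w_{\alpha\beta}(z)=\sum_{j\ge0}\bar w_{j,\alpha\beta}z^{j}$; $\bar\Psi^*_{\alpha\beta}(\mathbf s,\mathbf t,\bar{\mathbf t};z)=z^{-s_\alpha}e^{-\xi(\bar{\mathbf t}_\alpha,z^{-1})}\bar w^*_{\alpha\beta}(\mathbf s,\mathbf t,\bar{\mathbf t};z)$, $\bar w^*_{\alpha\beta}(z)=\sum_{j\ge0}\bar w^*_{j,\alpha\beta}z^{j}$; where all coefficients are functions of $(\mathbf s,\mathbf t,\bar{\mathbf t})$, $w_{0,\alpha\beta}=w^*_{0,\alpha\beta}=\delta_{\alpha\beta}$, and the matrices $\bar w_0=(\bar w_{0,\alpha\beta})$, $\bar w_0^*=(\bar w^*_{0,\alpha\beta})$ are invertible. (Functions satisfying the bilinear identity and having this form are exactly the wave functions and adjoint wave functions of the $N$-component Toda lattice hierarchy.) Functions of the times are treated as formal power series in $\mathbf t,\bar{\mathbf t}$. $C_\infty$ is a big circle around $\infty$; $\oint_{C_\infty}$ means $2\pi i$ times the coefficient of $z^{-1}$ of the formal series in the integrand, expanded as a formal power series in $\mathbf t-\mathbf t'$, $\bar{\mathbf t}-\bar{\mathbf t}'$. *)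

(* Defs.v *)
From HB Require Import structures.
From mathcomp Require Import all_boot all_order all_algebra.
From mathcomp Require Import finmap multiset.
From mathcomp Require Import mathcomp_extra boolp classical_sets functions.
From mathcomp Require Import cardinality fsbigop reals trigo.
From mathcomp Require Import complex.
From mathcomp Require Import zify.

Set Implicit Arguments.
Unset Strict Implicit.
Unset Printing Implicit Defensive.

Import Order.TTheory GRing.Theory Num.Theory.

Local Open Scope classical_set_scope.
Local Open Scope ring_scope.

Section Convolution.
Variables (M : choiceType) (op : M -> M -> M) (e : M) (K : comNzRingType).
Implicit Types (f g h : M -> K) (m : M) (S : {fset M}).

(* A sum indexed with \in is 0 by convention when infinitely many of its terms
   are nonzero; this does not happen for the series to which conv is applied
   below, see msubsets_finite and int_interval_finite. *)
Definition conv f g m : K :=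
  \sum_(p \in [set p : M * M | op p.1 p.2 = m]) f p.1 * g p.2.

Definition delta : M -> K := fun m => (m == e)%:R.

Lemma conv_fset S f g m :
  (forall a b, op a b = m -> f a != 0 -> g b != 0 -> a \in S /\ b \in S) ->
  conv f g m =
  \sum_(a <- S) \sum_(b <- S) if op a b == m then f a * g b else 0.
Proof.
move=> hS; rewrite /conv fsbig_mkcond.
rewrite (fsbigE [seq (a, b) | a <- S, b <- S]) //.
- under eq_bigl do rewrite in_setT.
  rewrite big_allpairs_dep /=.
  apply: eq_bigr => a _; apply: eq_bigr => b _.
  rewrite /patch; case: eqP => ab; first by rewrite mem_set.
  by rewrite memNset.
- by apply: allpairs_uniq => // -[a b] [c d] _ _ /= [-> ->].
- move=> [a b] _ /negP abS; rewrite /patch; case: ifPn => //; rewrite inE /= => ab.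
  have [-> | fa] := eqVneq (f a) 0; first by rewrite mul0r.
  have [-> | gb] := eqVneq (g b) 0; first by rewrite mulr0.
  have [aS bS] := hS _ _ ab fa gb.
  by case: abS; apply/allpairsP; exists (a, b).
Qed.

Lemma conv_neq0 f g m : conv f g m != 0 ->
  exists a b, [/\ op a b = m, f a != 0 & g b != 0].
Proof.
apply: contra_neqP => H; apply: fsbig1 => -[a b] /= ab.
apply/eqP; apply: contra_notT H => fg0; exists a, b; split=> //.
  by apply: contraNneq fg0 => ->; rewrite mul0r.
by apply: contraNneq fg0 => ->; rewrite mulr0.
Qed.

Hypothesis opC : commutative op.

Lemma convC f g m : conv f g m = conv g f m.
Proof.
rewrite /conv (reindex_fsbig (fun p => (p.2, p.1)) [set p | op p.1 p.2 = m]).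
  by apply: eq_fsbigr => p _; rewrite mulrC.
split.
- by move=> p /=; rewrite opC.
- by move=> [a b] [c d] _ _ /= [-> ->].
- by move=> [a b] /= ab; exists (b, a) => //=; rewrite opC.
Qed.

Lemma convDl S f1 f2 g m :
  (forall a b, op a b = m -> g b != 0 -> f1 a != 0 -> a \in S /\ b \in S) ->
  (forall a b, op a b = m -> g b != 0 -> f2 a != 0 -> a \in S /\ b \in S) ->
  conv (f1 \+ f2) g m = conv f1 g m + conv f2 g m.
Proof.
move=> h1 h2; rewrite !(@conv_fset S); [|by auto..|].
  rewrite -big_split; apply: eq_bigr => a _ /=.
  rewrite -big_split; apply: eq_bigr => b _ /=.
  by case: ifP => _; rewrite ?addr0 // mulrDl.
move=> a b ab /= f12 gb; have [f10|] := eqVneq (f1 a) 0; last by auto.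
by apply: h2 => //; apply: contraNneq f12 => ->; rewrite f10 addr0.
Qed.

Lemma conv3 S f g h m :
  (forall a b c, op a (op b c) = m -> f a != 0 -> g b != 0 -> h c != 0 ->
     [/\ a \in S, b \in S, c \in S & op b c \in S]) ->
  conv f (conv g h) m =
  \sum_(a <- S) \sum_(b <- S) \sum_(c <- S)
    if op a (op b c) == m then f a * (g b * h c) else 0.
Proof.
move=> hS; rewrite (@conv_fset S); last first.
  move=> a k ak fa /conv_neq0 [b [c [bc gb hc]]]; subst k.
  by have [] := hS _ _ _ ak fa gb hc.
apply: eq_bigr => a _.
have [fa | fa] := eqVneq (f a) 0.
  rewrite !big1 // => b _; rewrite ?fa ?mul0r ?if_same //.
  by rewrite big1 // => c _; rewrite mul0r if_same.
transitivity (\sum_(k <- S) \sum_(b <- S) \sum_(c <- S)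
    if op a k == m then if op b c == k then f a * (g b * h c) else 0 else 0).
  apply: eq_bigr => k _; case: eqP => ak; last first.
    by rewrite big1 // => b _; rewrite big1.
  rewrite (@conv_fset S); last first.
    move=> b c bc gb hc; subst k.
    by have [] := hS _ _ _ ak fa gb hc.
  rewrite mulr_sumr; apply: eq_bigr => b _.
  rewrite mulr_sumr; apply: eq_bigr => c _.
  by case: ifP => _; rewrite ?mulr0.
rewrite exchange_big; apply: eq_bigr => b _ /=.
rewrite exchange_big; apply: eq_bigr => c _ /=.
have [bcS|bcS] := boolP (op b c \in S).
  rewrite (big_fsetD1 (op b c)) //= eqxx big1_fset ?addr0 //.
  move=> k; rewrite !inE => /andP[kbc _] _.
  by rewrite (negPf (_ : op b c != k)) ?if_same // eq_sym.
rewrite big1_seq; last first.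
  move=> k /andP[_ kS]; rewrite (negPf (_ : op b c != k)) ?if_same //.
  by apply: contraNneq bcS => ->.
case: eqP => // abc.
have [-> | gb] := eqVneq (g b) 0; first by rewrite mul0r mulr0.
have [-> | hc] := eqVneq (h c) 0; first by rewrite !mulr0.
by have [_ _ _] := hS _ _ _ abc fa gb hc; rewrite (negPf bcS).
Qed.

Hypothesis opA : associative op.

Lemma convA S f g h m :
  (forall a b c, op a (op b c) = m -> f a != 0 -> g b != 0 -> h c != 0 ->
     [/\ a \in S, b \in S, c \in S, op a b \in S & op b c \in S]) ->
  conv f (conv g h) m = conv (conv f g) h m.
Proof.
move=> hS; rewrite [RHS]convC !(@conv3 S); last 2 first.
- move=> c a b cab hc fa gb.
  by have [] := hS a b c _ fa gb hc; rewrite // opA opC.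
- by move=> a b c abc fa gb hc; have [] := hS a b c abc fa gb hc.
rewrite [RHS]exchange_big; apply: eq_bigr => a _ /=.
rewrite [RHS]exchange_big; apply: eq_bigr => b _ /=.
apply: eq_bigr => c _; rewrite (opC c) opA.
by case: ifP => // _; rewrite [RHS]mulrC mulrA.
Qed.

Hypothesis op1 : left_id e op.

Lemma conv1 f m : conv delta f m = f m.
Proof.
rewrite (@conv_fset [fset e; m]%fset).
  rewrite (big_fsetD1 e) ?inE ?eqxx //= [X in _ + X]big1_seq ?addr0.
    rewrite (big_fsetD1 m) ?inE ?eqxx ?orbT //= op1 eqxx /delta eqxx mul1r.
    rewrite big1_seq ?addr0 // => b; rewrite !inE op1 => /andP[_ /andP[/negPf-> _]] //.
  move=> a; rewrite !inE => /andP[_ /andP[/negPf ae _]].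
  by rewrite big1 // => b _; rewrite /delta ae mul0r if_same.
move=> a b ab; rewrite /delta; have [ae _ _|] := eqVneq a e; last by rewrite eqxx.
by rewrite -ab ae op1 !inE !eqxx orbT.
Qed.

End Convolution.

(* Formal power series in a possibly infinite family V of variables: the
   coefficient of the monomial prod_(v <- m) v is f m. *)
Definition fps (V : choiceType) (K : comNzRingType) := {mset V}%mset -> K.

Section FpsRing.
Variables (V : choiceType) (K : comNzRingType).
Local Open Scope mset_scope.
Implicit Types (f g h : fps V K) (m : {mset V}).

HB.instance Definition _ := GRing.Zmodule.copy (fps V K) ({mset V} -> K).

Definition fps_one : fps V K := delta mset0 K.
Definition fps_mul f g : fps V K := fun m => conv (@msetD V) f g m.

Lemma msubsets_finite m : exists S : {fset {mset V}},
  forall a, a `<=` m -> a \in S.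
Proof.
exists [fset seq_mset (mask (b : (size m).-tuple bool) m)
         | b in {: (size m).-tuple bool}]%fset.
move=> a /msubsetP am.
have /count_subseqP [s /subseqP [b sb ->] sa] :
    forall x, (count_mem x a <= count_mem x m)%N.
  by move=> x; rewrite !count_mem_mset.
apply/imfsetP; have /eqP sb' := sb; exists (Tuple sb') => //=.
by rewrite -[LHS]seq_mset_id; apply/eq_seq_msetP.
Qed.

Let subDl (a b : {mset V}) : a `<=` a `+` b.
Proof. by apply/msubsetP => x; rewrite msetE2 leq_addr. Qed.
Let subDr (a b : {mset V}) : b `<=` a `+` b.
Proof. by rewrite msetDC. Qed.

Let fps_mulC : commutative fps_mul.
Proof. by move=> f g; apply/funext => m; apply: convC; exact: msetDC. Qed.

Let fps_mulA : associative fps_mul.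
Proof.
move=> f g h; apply/funext => m; have [S hS] := msubsets_finite m.
apply: (@convA _ _ _ (@msetDC V) (@msetDA V) S) => a b c abc _ _ _; subst m.
split; apply: hS; rewrite ?subDl ?subDr //.
- by rewrite msetDCA subDl.
- by rewrite msetDA subDr.
by rewrite msetDA subDl.
Qed.

Let fps_mul1 : left_id fps_one fps_mul.
Proof. by move=> f; apply/funext => m; apply: conv1; exact: mset0D. Qed.

Let fps_mulDl : left_distributive fps_mul +%R.
Proof.
move=> f g h; apply/funext => m; have [S hS] := msubsets_finite m.
by apply: (@convDl _ _ _ S) => a b ab _ _; subst m; split; apply: hS.
Qed.

Let fps_oner_neq0 : fps_one != 0.
Proof.
apply/eqP => /(congr1 (fun f : fps V K => f mset0)) /eqP.
by rewrite /fps_one /delta eqxx oner_eq0.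
Qed.

HB.instance Definition _ := GRing.Zmodule_isComNzRing.Build (fps V K)
  fps_mulA fps_mulC fps_mul1 fps_mulDl fps_oner_neq0.

Definition fps_unit : {pred fps V K} := fun f => `[< exists g, g * f = 1 >].
Definition fps_inv f : fps V K := xget f [set g | g * f = 1].

Let fps_mulVx : {in fps_unit, left_inverse 1 fps_inv *%R}.
Proof. by move=> f /asboolP /(xgetPex f). Qed.

Let fps_unitPl f g : g * f = 1 -> fps_unit f.
Proof. by move=> gf; apply/asboolP; exists g. Qed.

Let fps_invr_out : {in [predC fps_unit], fps_inv =1 id}.
Proof.
move=> f /asboolPn fN; rewrite /fps_inv; case: xgetP => //= g _ gf.
by case: fN; exists g.
Qed.

HB.instance Definition _ := GRing.ComNzRing_hasMulInverse.Build (fps V K)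
  fps_mulVx fps_unitPl fps_invr_out.

End FpsRing.

Section FpsOps.
Variables (V : choiceType) (K : comNzRingType).
Local Open Scope mset_scope.

Definition fps_const (a : K) : fps V K := fun m => if m == mset0 then a else 0.

Definition fps_linear (c : V -> K) : fps V K :=
  fun m => if (m : seq V) is [:: v] then c v else 0.

(* The exponential of a series f without constant term: f ^+ n has no monomial
   of degree less than n, so the coefficient at m only involves n <= size m. *)
Definition fps_exp (f : fps V K) : fps V K :=
  fun m => (\sum_(n < (size m).+1) f ^+ n / (n`!)%:R) m.

End FpsOps.

(* The point around which Laurent series in z are expanded. *)
Variant zpoint := Zero | Infinity.

(* The order of vanishing of z ^ n. *)
Definition zorder (d : zpoint) (n : int) : int :=
  if d is Infinity then - n else n.

(* laurent K Zero is K((z)) and laurent K Infinity is K((z^-1)); in both cases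
   lcoef f n is the coefficient of z ^ n. *)
Record laurent (K : comNzRingType) (d : zpoint) := Laurent {
  lcoef :> int -> K;
  lcoef_bounded : exists b : int, forall n, lcoef n != 0 -> b <= zorder d n
}.

Section LaurentRing.
Variables (K : comNzRingType) (d : zpoint).
Local Notation L := (laurent K d).
Implicit Types f g h : L.

Lemma laurentP f g : (forall n, f n = g n) <-> f = g.
Proof.
split=> [|-> //]; case: f g => [f hf] [g hg] /= /funext fg; subst g.
by congr Laurent; apply: Prop_irrelevance.
Qed.

HB.instance Definition _ := gen_eqMixin L.
HB.instance Definition _ := gen_choiceMixin L.

Lemma zorderD m n : zorder d (m + n) = zorder d m + zorder d n.
Proof. by case: d; rewrite //= opprD. Qed.

Fact laurent_add_bounded f g :
  exists b : int, forall n, f n + g n != 0 -> b <= zorder d n.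
Proof.
have [[b1 h1] [b2 h2]] := (lcoef_bounded f, lcoef_bounded g).
exists (Num.min b1 b2) => n fg0; rewrite ge_min.
have [f0|/h1->//] := eqVneq (f n) 0.
by rewrite h2 ?orbT //; apply: contraNneq fg0 => ->; rewrite f0 addr0.
Qed.

Fact laurent_opp_bounded f :
  exists b : int, forall n, - f n != 0 -> b <= zorder d n.
Proof.
have [b h] := lcoef_bounded f.
by exists b => n; rewrite oppr_eq0; apply: h.
Qed.

Fact monomial_bounded (a : K) (k : int) :
  exists b : int, forall n, (if n == k then a else 0) != 0 -> b <= zorder d n.
Proof. by exists (zorder d k) => n; case: (n =P k) => [->|]; rewrite ?eqxx. Qed.

Fact laurent_mul_bounded f g :
  exists b : int, forall n, conv +%R f g n != 0 -> b <= zorder d n.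
Proof.
have [[b1 h1] [b2 h2]] := (lcoef_bounded f, lcoef_bounded g).
exists (b1 + b2) => n /conv_neq0 [i [j [<- fi gj]]].
by rewrite zorderD lerD ?h1 ?h2.
Qed.

Definition monomial a k : L := Laurent (monomial_bounded a k).
Lemma monomial_neq0 a k n : monomial a k n != 0 -> n = k.
Proof. by move=> /=; case: (n =P k) => [->|]; rewrite ?eqxx. Qed.

Definition laurent_add f g : L := Laurent (laurent_add_bounded f g).
Definition laurent_opp f : L := Laurent (laurent_opp_bounded f).
Definition laurent_mul f g : L := Laurent (laurent_mul_bounded f g).

Let laurent_addA : associative laurent_add.
Proof. by move=> f g h; apply/laurentP => n /=; rewrite addrA. Qed.
Let laurent_addC : commutative laurent_add.
Proof. by move=> f g; apply/laurentP => n /=; rewrite addrC. Qed.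
Let laurent_add0 : left_id (monomial 0 0) laurent_add.
Proof. by move=> f; apply/laurentP => n /=; rewrite if_same add0r. Qed.
Let laurent_addN : left_inverse (monomial 0 0) laurent_opp laurent_add.
Proof. by move=> f; apply/laurentP => n /=; rewrite if_same addNr. Qed.

HB.instance Definition _ := GRing.isZmodule.Build L
  laurent_addA laurent_addC laurent_add0 laurent_addN.

Lemma int_interval_finite (a b : int) : exists S : {fset int},
  forall i, a <= i -> i <= b -> i \in S.
Proof.
exists [fset (a + k%:Z)%R | k in iota 0 `|(b - a)%R|%N.+1]%fset => i ai ib.
apply/imfsetP; exists `|(i - a)%R|%N; last by lia.
by rewrite inE mem_iota; lia.
Qed.

Let supp3 f g h (m : int) : exists S : {fset int}, forall a b c : int,
  a + (b + c) = m -> f a != 0 -> g b != 0 -> h c != 0 ->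
  [/\ a \in S, b \in S, c \in S, a + b \in S & b + c \in S].
Proof.
have [[b1 h1] [b2 h2]] := (lcoef_bounded f, lcoef_bounded g).
have [b3 h3] := lcoef_bounded h.
pose B : int := `|b1| + `|b2| + `|b3| + `|m|.
have [S hS] := int_interval_finite (- B) B.
exists S => a b c abc /h1 fa /h2 gb /h3 hc.
by split; apply: hS; move: fa gb hc; rewrite /zorder /B; case: d; lia.
Qed.

Let laurent_mulC : commutative laurent_mul.
Proof. by move=> f g; apply/laurentP => n; apply/convC/addrC. Qed.

Let laurent_mulA : associative laurent_mul.
Proof.
move=> f g h; apply/laurentP => n; have [S hS] := supp3 f g h n.
by exact: (@convA _ _ _ (@addrC _) (@addrA _) S).
Qed.

Let laurent_mul1 : left_id (monomial 1 0) laurent_mul.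
Proof.
move=> f; apply/laurentP => n; rewrite /= -[RHS](@conv1 _ +%R 0 K).
  by congr conv; apply/funext => i; rewrite /delta; case: eqP.
exact: add0r.
Qed.

Let laurent_mulDl : left_distributive laurent_mul +%R.
Proof.
move=> f g h; apply/laurentP => n.
have [S1 h1] := supp3 f h (monomial 1 0) n.
have [S2 h2] := supp3 g h (monomial 1 0) n.
apply: (@convDl _ _ _ (S1 `|` S2)%fset) => a b ab hb fa.
  have [||//|/=|aS bS _ _ _] := h1 a b 0; rewrite ?eqxx ?oner_neq0 ?addr0 //.
  by rewrite !inE aS bS.
have [||//|/=|aS bS _ _ _] := h2 a b 0; rewrite ?eqxx ?oner_neq0 ?addr0 //.
by rewrite !inE aS bS !orbT.
Qed.

Let laurent_oner_neq0 : monomial 1 0 != 0.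
Proof.
apply/eqP => /laurentP /(_ 0) /= /eqP.
by rewrite oner_eq0.
Qed.

HB.instance Definition _ := GRing.Zmodule_isComNzRing.Build L
  laurent_mulA laurent_mulC laurent_mul1 laurent_mulDl laurent_oner_neq0.

End LaurentRing.

Section Toda.
Variables (R : realType) (N : nat).
Local Notation C := R[i].
Local Open Scope mset_scope.

(* (false, a, k) stands for t_{a,k+1} and (true, a, k) for \bar t_{a,k+1}. *)
Definition tvar : choiceType := (bool * 'I_N * nat)%type.

(* Functions of the times, and Laurent series in z depending on the times. *)
Definition tseries := fps tvar C.
Definition zseries (d : zpoint) := fps tvar (laurent C d).

Section AnyPoint.
Variable d : zpoint.

Definition of_tseries (f : tseries) : zseries d := fun m => monomial d (f m) 0.

Definition zpow (n : int) : zseries d := fps_const (monomial d 1 n).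

(* xi(t_a, z ^ e), or xi(\bar t_a, z ^ e) if bar holds. *)
Definition xi (bar : bool) (a : 'I_N) (e : int) : zseries d :=
  fps_linear (fun v : tvar => let: (bar', a', k) := v in
    if (bar' == bar) && (a' == a) then monomial d 1 (e * k.+1%:Z) else 0).

Fact expansion_bounded (w : nat -> tseries) m : exists b : int, forall n,
  (if 0 <= zorder d n then w `|n|%N m else 0) != 0 -> b <= zorder d n.
Proof. by exists 0 => n; case: ifP; rewrite ?eqxx. Qed.

(* \sum_j w_j z^j at 0 and \sum_j w_j z^-j at infinity. *)
Definition expansion (w : nat -> tseries) : zseries d :=
  fun m => Laurent (expansion_bounded w m).

End AnyPoint.

Fact subst_zV_bounded (f : laurent C Zero) :
  exists b : int, forall n, f (- n) != 0 -> b <= zorder Infinity n.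
Proof. by have [b h] := lcoef_bounded f; exists b => n /h. Qed.

Definition laurent_zV (f : laurent C Zero) : laurent C Infinity :=
  Laurent (subst_zV_bounded f).

(* The substitution of z^-1 for z. *)
Definition zV (f : zseries Zero) : zseries Infinity :=
  fun m => laurent_zV (f m).

(* The increment of the variable v in t + eps [z^-1]_a, or in
   \bar t + eps [z^-1]_a if bar holds. *)
Definition miwa (eps : C) (bar : bool) (a : 'I_N) (v : tvar) :
    laurent C Infinity :=
  let: (bar', a', k) := v in
  if (bar' == bar) && (a' == a)
  then monomial Infinity (eps / k.+1%:R) (- k.+1%:Z) else 0.

(* The binomial formula for f(t + c), where c := miwa eps bar a; the sum has
   finite support by shift_finite. *)
Definition shift_term eps bar a (f : tseries) (m k : {mset tvar}) :
    laurent C Infinity :=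
  monomial _ (f (m `+` k) *+ \prod_(v <- undup k) 'C((m `+` k) v, m v)) 0 *
  \prod_(v <- k) miwa eps bar a v.

Definition shift_coef eps bar a f m (n : int) : C :=
  \sum_(k \in [set: {mset tvar}]) shift_term eps bar a f m k n.

Lemma miwa_prod_neq0 eps bar a (s : seq tvar) n :
  (\prod_(v <- s) miwa eps bar a v) n != 0 ->
  all (fun v => v.1 == (bar, a)) s /\ n = - \sum_(v <- s) v.2.+1%:Z.
Proof.
elim: s n => [|[[bar' a'] k] s IHs] n; rewrite ?big_nil ?big_cons /=.
  by move=> /(@monomial_neq0 _ Infinity) ->.
move=> /conv_neq0 [i [j [<- + /IHs [-> ->]]]]; rewrite andbT -pair_eqE /=.
case: ifP => /= _; last by rewrite if_same eqxx.
by rewrite opprD => /(@monomial_neq0 _ Infinity) ->.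
Qed.

Lemma shift_term_neq0 eps bar a f m k n :
  shift_term eps bar a f m k n != 0 ->
  all (fun v => v.1 == (bar, a)) k /\ n = - \sum_(v <- k) v.2.+1%:Z.
Proof.
move=> /conv_neq0 [i [j [<- + /miwa_prod_neq0 [-> ->]]]] /=.
by move=> /(@monomial_neq0 _ Infinity) ->; rewrite add0r.
Qed.

Lemma shift_finite eps bar a f m n : finite_set
  [set k : {mset tvar} | shift_term eps bar a f m k n != 0].
Proof.
pose B := seq_mset (flatten (nseq `|n|%N
  [seq (bar, a, j) : tvar | j <- iota 0 `|n|%N])).
have [S hS] := msubsets_finite B.
apply: (sub_finite_set _ (finite_fset S)) => k0 /=.
pose k : {mset tvar} := k0; rewrite -[k0]/k => /shift_term_neq0 [ka nE].
apply: hS; apply/msubsetP => v; rewrite mset_seqE.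
have nS : `|n|%N = (\sum_(v <- k) v.2.+1)%N.
  by rewrite nE -(big_morph Posz PoszD (erefl _)) abszN.
rewrite count_flatten map_nseq sumn_nseq.
have [vk|] := boolP (v \in k); last by rewrite in_mset -eqn0Ngt => /eqP->.
have := allP ka v vk; case: v vk => -[b' a'] j vk /= /eqP [? ?]; subst b' a'.
have jn : (j < `|n|)%N.
  by rewrite nS (big_rem _ vk) /= leq_addr.
rewrite count_uniq_mem; last first.
  by rewrite map_inj_uniq ?iota_uniq // => x y [].
rewrite map_f ?mem_iota // mul1n nS -count_mem_mset -sum1_count.
rewrite big_mkcond; apply: leq_sum => x _.
by case: ifP.
Qed.

Fact shift_bounded eps bar a f m : exists b : int, forall n,
  shift_coef eps bar a f m n != 0 -> b <= zorder Infinity n.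
Proof.
exists 0 => n; apply: contra_neqT; rewrite -ltNge /= => n0.
apply: fsbig1 => k _; apply: contraTeq n0 => /shift_term_neq0 [_ ->].
by rewrite opprK -leNgt sumr_ge0.
Qed.

(* f(t + eps [z^-1]_a), or f(\bar t + eps [z^-1]_a) if bar holds. *)
Definition shift eps bar a (f : tseries) : zseries Infinity :=
  fun m => Laurent (shift_bounded eps bar a f m).

(* The integral of f dz along a big circle around infinity. *)
Definition contour_int (f : laurent C Infinity) : C :=
  (0 +i* (2 * pi))%C * f (- 1).

Local Notation sites := 'rV[int]_N.

(* In the forms below s 0 a is the a-th component of s, and w s j is the matrix
   of the coefficients w_{j,ab}(s, t, \bar t). *)
Definition Psi_form (Psi : sites -> 'M[zseries Infinity]_N) :=
  exists w : sites -> nat -> 'M[tseries]_N,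
    (forall s, w s 0%N = 1%:M) /\
    forall s a b, Psi s a b =
      zpow _ (s 0 b) * fps_exp (xi _ false b 1) *
      expansion _ (fun j => w s j a b).

Definition Psi_adj_form (Psi' : sites -> 'M[zseries Infinity]_N) :=
  exists w' : sites -> nat -> 'M[tseries]_N,
    (forall s, w' s 0%N = 1%:M) /\
    forall s a b, Psi' s a b =
      zpow _ (- s 0 a) * fps_exp (- xi _ false a 1) *
      expansion _ (fun j => w' s j a b).

Definition barPsi_form (bPsi : sites -> 'M[zseries Zero]_N) :=
  exists bw : sites -> nat -> 'M[tseries]_N,
    (forall s, bw s 0%N \in unitmx) /\
    forall s a b, bPsi s a b =
      zpow _ (s 0 b) * fps_exp (xi _ true b (- 1)) *
      expansion _ (fun j => bw s j a b).

Definition barPsi_adj_form (bPsi' : sites -> 'M[zseries Zero]_N) :=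
  exists bw' : sites -> nat -> 'M[tseries]_N,
    (forall s, bw' s 0%N \in unitmx) /\
    forall s a b, bPsi' s a b =
      zpow _ (- s 0 a) * fps_exp (- xi _ true a (- 1)) *
      expansion _ (fun j => bw' s j a b).

(* Both sides are power series in the two independent families of times
   (t, \bar t) and (t', \bar t'), compared at the monomial t^m t'^m'; passing
   to the variables t - t' is a linear change of variables, which commutes
   with taking residues in z. *)
Definition bilinear_identity
    (Psi Psi' : sites -> 'M[zseries Infinity]_N)
    (bPsi bPsi' : sites -> 'M[zseries Zero]_N) :=
  forall (a b : 'I_N) (s s' : sites) (m m' : {mset tvar}),
    \sum_(g < N) contour_int (Psi s a g m * Psi' s' g b m') =
    \sum_(g < N) contour_int
      (zV (bPsi s a g) m * zV (bPsi' s' g b) m' * monomial Infinity 1 (- 2)).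

End Toda.

(* Main.v *)
Require Import Defs.
From HB Require Import structures.
From mathcomp Require Import all_boot all_order all_algebra.
From mathcomp Require Import finmap multiset.
From mathcomp Require Import mathcomp_extra boolp classical_sets functions.
From mathcomp Require Import cardinality fsbigop reals trigo.
From mathcomp Require Import complex.
From mathcomp Require Import zify ring.

Set Implicit Arguments.
Unset Strict Implicit.
Unset Printing Implicit Defensive.

Import Order.TTheory GRing.Theory Num.Theory.

Local Open Scope ring_scope.

(* Let U_(a,i)(s; z), with i = (false, g) or (true, g), stand for the power
   series in z^-1 left of Psi_ag(z), resp. bar Psi_ag(z^-1), once its factor
   z^(..) e^xi is removed, and let S_i(p) be the shift t_g -> t_g - [p^-1]
   for i = (false, g), and bar t_g -> bar t_g - [p^-1] together with
   s -> s + [1]_g for i = (true, g). Applying one shift S_i(p) to the adjoint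
   functions in the bilinear identity expresses the off-diagonal entries and
   the adjoint functions through u_i := U_(g,i) and the coefficients of z^-1
   in Psi. Applying two shifts S_i(p) and S_j(q) then gives the cocycle relation
     u_i(p) S_i(p) u_j(q) = u_j(q) S_j(q) u_i(p),
   which is what is needed to solve S_i(p) tau = u_i(p) tau: its logarithmic
   derivative along the vector field in p and the times that annihilates
   S_i(p) is a closed system for the derivatives of log tau, integrated by the
   Poincare lemma for formal power series and, in the discrete variable s, by
   summation along lattice paths. *)

(** * Formal power series in one variable *)

(** The variable of [ps] stands for z^-1, so p below is the inverse of the p above, and on the times
    S_i(p) is the exponential of - sum_k p^(k+1) d_(i,k) / (k+1). It multiplies the factor e^-xi of
    the adjoint function by 1 / (1 - p z): residues become evaluations at z^-1 = p, and two poles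
    are separated by partial fractions. After z -> z^-1 the barred functions look like the unbarred
    ones with s negated, so one kind of letter treats both; the remaining difference is the factor
    [cvar], equal to p or -1, from which the powers z^(delta-1) and the signs (-1)^(delta-1) of the
    theorem come. Shifts are handled as solutions of a differential equation in p rather than
    through Taylor's formula: multiplicativity, commutation and finally S_i(p) tau = u_i(p) tau
    follow from uniqueness of the solution, which only asks that the coefficients have no torsion.
    Only the diagonal functions u_i enter the cocycle; the off-diagonal tau_ab is then forced to be
    tau times the coefficient of z^-1 in Psi_ab. *)

Lemma sum_triangle (V : nmodType) n (F : nat -> nat -> V) :
  \sum_(i < n.+1) \sum_(j < (n - i).+1) F i j =
  \sum_(j < n.+1) \sum_(i < (n - j).+1) F i j.
Proof.
under eq_bigr => i _ do
  rewrite (big_ord_widen n.+1 (F i)) ?ltnS ?leq_subr //.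
rewrite (exchange_big_dep xpredT) //=; apply: eq_bigr => j _.
rewrite [RHS](big_ord_widen n.+1 (F^~ j)) ?ltnS ?leq_subr //.
by apply: eq_bigl => i; have := (ltn_ord i, ltn_ord j) => -[]; lia.
Qed.

Definition ps (K : comNzRingType) := nat -> K.

Section PowerSeriesRing.
Variable K : comNzRingType.
Implicit Types (f g h : ps K) (c : K).

HB.instance Definition _ := GRing.Zmodule.copy (ps K) (nat -> K).

Definition psC c : ps K := fun n => if n is 0%N then c else 0.
Definition psX : ps K := fun n => (n == 1%N)%:R.
Definition tl f : ps K := fun n => f n.+1.
Definition ps_mul f g : ps K := fun n => \sum_(i < n.+1) f i * g (n - i)%N.

Let ps_mul0 f g : ps_mul f g 0%N = f 0%N * g 0%N.
Proof. by rewrite /ps_mul big_ord1. Qed.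

Let ps_mulS f g n :
  ps_mul f g n.+1 = f 0%N * g n.+1 + ps_mul (tl f) g n.
Proof. by rewrite /ps_mul big_ord_recl. Qed.

Let ps_mulC : commutative ps_mul.
Proof.
move=> f g; apply/funext => n; rewrite /ps_mul (reindex_inj rev_ord_inj) /=.
by apply: eq_bigr => i _; rewrite mulrC subSS subKn // -ltnS.
Qed.

Let ps_mulDl : left_distributive ps_mul +%R.
Proof.
move=> f g h; apply/funext => n; rewrite /ps_mul /=.
rewrite -[RHS]/(_ + _) -big_split /=.
by apply: eq_bigr => i _; rewrite -mulrDl.
Qed.

Let ps_mulA : associative ps_mul.
Proof.
move=> f g h; apply/funext => n; elim: n f g h => [|n IHn] f g h.
  by rewrite !ps_mul0 mulrA.
rewrite !ps_mulS ps_mul0 IHn mulrDr !mulrA -addrA; congr (_ + _).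
have -> : tl (ps_mul f g) = (fun k => f 0%N * tl g k) + ps_mul (tl f) g.
  by apply/funext => k; rewrite /tl ps_mulS.
rewrite ps_mulDl -[RHS]/(_ + _); congr (_ + _).
by rewrite /ps_mul mulr_sumr; apply: eq_bigr => i _; rewrite mulrA.
Qed.

Let ps_mul1 : left_id (psC 1) ps_mul.
Proof.
move=> f; apply/funext => n; rewrite /ps_mul big_ord_recl mul1r subn0.
by rewrite big1 ?addr0 // => i _; rewrite mul0r.
Qed.

Let ps_oner_neq0 : psC 1 != 0.
Proof. by apply/eqP => /(congr1 (@^~ 0%N))/eqP; rewrite (oner_eq0 K). Qed.

HB.instance Definition _ := GRing.Zmodule_isComNzRing.Build (ps K)
  ps_mulA ps_mulC ps_mul1 ps_mulDl ps_oner_neq0.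

Lemma psP f g : f =1 g -> f = g. Proof. exact: funext. Qed.
Lemma psDE f g n : (f + g) n = f n + g n. Proof. by []. Qed.
Lemma psNE f n : (- f) n = - f n. Proof. by []. Qed.
Lemma psME f g n : (f * g) n = \sum_(i < n.+1) f i * g (n - i)%N.
Proof. by []. Qed.
Lemma psM0 f g : (f * g) 0%N = f 0%N * g 0%N. Proof. exact: ps_mul0. Qed.
Lemma psMS f g n : (f * g) n.+1 = f 0%N * g n.+1 + (tl f * g) n.
Proof. exact: ps_mulS. Qed.

Lemma ps_sumE I (r : seq I) (P : pred I) (F : I -> ps K) n :
  (\sum_(i <- r | P i) F i) n = \sum_(i <- r | P i) F i n.
Proof. by elim/big_rec2: _ => // i x f _ <-. Qed.

Lemma ps_mulrnE f k n : (f *+ k) n = f n *+ k.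
Proof. by elim: k => // k IHk; rewrite !mulrS psDE IHk. Qed.

Lemma psCM c f n : (psC c * f) n = c * f n.
Proof.
rewrite psME big_ord_recl subn0 big1 ?addr0 // => i _; exact: mul0r.
Qed.

Lemma psMC c f n : (f * psC c) n = f n * c.
Proof. by rewrite mulrC psCM mulrC. Qed.

Lemma psXM0 f : (psX * f) 0%N = 0.
Proof. by rewrite psM0 mul0r. Qed.

Lemma psXMS f n : (psX * f) n.+1 = f n.
Proof.
rewrite psMS mul0r add0r; have -> : tl psX = 1 by apply: psP => -[].
by rewrite mul1r.
Qed.

Lemma psX_inj : injective (fun f => psX * f).
Proof. by move=> f g fg; apply: psP => n; rewrite -psXMS fg psXMS. Qed.

Let psC_additive : additive psC.
Proof. by move=> c c'; apply: psP => -[|n] //; rewrite psDE psNE subr0. Qed.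
HB.instance Definition _ := GRing.isAdditive.Build K (ps K) psC psC_additive.
Let psC_mul : monoid_morphism psC.
Proof. by split=> // c c'; apply: psP => -[|n]; rewrite psCM //= mulr0. Qed.
HB.instance Definition _ := GRing.isMonoidMorphism.Build K (ps K) psC psC_mul.

End PowerSeriesRing.

Arguments psX {K}.

Section Maps.
Variables K L : comNzRingType.

Definition psmap (g : K -> L) (f : ps K) : ps L := fun n => g (f n).

Variable g : {rmorphism K -> L}.

Let psmap_additive : additive (psmap g).
Proof. by move=> f f'; apply: psP => n; rewrite /psmap psDE psNE raddfB. Qed.
HB.instance Definition _ :=
  GRing.isAdditive.Build (ps K) (ps L) (psmap g) psmap_additive.
Let psmap_mul : monoid_morphism (psmap g).
Proof.
split=> [|f f']; apply: psP => n.
  by case: n => [|n]; rewrite /psmap ?rmorph1 ?rmorph0.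
by rewrite /psmap !psME rmorph_sum; apply: eq_bigr => i _; rewrite rmorphM.
Qed.
HB.instance Definition _ :=
  GRing.isMonoidMorphism.Build (ps K) (ps L) (psmap g) psmap_mul.

Lemma psmapX : psmap g psX = psX.
Proof. by apply: psP => n; rewrite /psmap /psX rmorph_nat. Qed.
Lemma psmapC c : psmap g (psC c) = psC (g c).
Proof. by apply: psP => -[|n]; rewrite /psmap ?rmorph0. Qed.

End Maps.

(** * Identification of the two variables of an iterated series *)

Section Diagonal.
Variable K : comNzRingType.

(* Substitution of the inner variable for the outer one. *)
Definition diag (F : ps (ps K)) : ps K :=
  fun n => \sum_(k < n.+1) F k (n - k)%N.

Lemma diagE (F : ps (ps K)) : diag F = F 0%N + psX * diag (tl F).
Proof.
apply: psP => -[|n]; first by rewrite psDE psXM0 addr0 /diag big_ord1.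
by rewrite psDE psXMS /diag big_ord_recl.
Qed.

Let diag_additive : additive diag.
Proof.
move=> F G; apply: psP => n; rewrite psDE psNE /diag -sumrB.
by apply: eq_bigr.
Qed.
HB.instance Definition _ :=
  GRing.isAdditive.Build (ps (ps K)) (ps K) diag diag_additive.

Lemma diagC (c : ps K) : diag (psC c) = c.
Proof.
apply: psP => n; rewrite /diag big_ord_recl subn0 big1 ?addr0 //.
Qed.

Lemma diagX : diag psX = psX.
Proof.
rewrite diagE (_ : tl psX = 1) ?[X in diag X](_ : 1 = psC 1) ?diagC //.
  by rewrite mulr1 add0r.
by apply: psP => -[].
Qed.

(** Splitting off the head of F leaves a product delayed by one power of the variable, so
    coefficient n + 1 reduces to the induction hypothesis at n. *)
Lemma diagM_coef n (F G : ps (ps K)) : diag (F * G) n = (diag F * diag G) n.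
Proof.
have diagM0 c H : diag (psC c * H) = c * diag H :> ps K.
  apply: psP => {}n; rewrite psME /diag.
  under eq_bigr do rewrite psCM psME.
  under [RHS]eq_bigr do rewrite mulr_sumr.
  rewrite (sum_triangle n (fun k i => c i * H k (n - k - i)%N)).
  apply: eq_bigr => i _; apply: eq_bigr => j _.
  by rewrite -!subnDA addnC.
elim: n F G => [|n IHn] F G.
  rewrite diagE psDE psXM0 addr0 [diag F]diagE [diag G]diagE.
  by rewrite !psM0 !psDE !psXM0 !addr0.
have -> : diag (F * G) = F 0%N * diag G + psX * diag (tl F * G).
  rewrite {1}diagE psM0 (_ : tl (F * G) = psC (F 0%N) * tl G + tl F * G).
    rewrite (raddfD diag) /= diagM0 [diag G]diagE !mulrDr.
    by rewrite -!addrA mulrCA.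
  by apply: psP => k; rewrite psDE psCM /tl psMS.
by rewrite [diag F]diagE mulrDl !psDE -mulrA !psXMS IHn.
Qed.

Let diag_mul : monoid_morphism diag.
Proof.
by split=> [|F G]; [exact: diagC | apply: psP => n; exact: diagM_coef].
Qed.
HB.instance Definition _ :=
  GRing.isMonoidMorphism.Build (ps (ps K)) (ps K) diag diag_mul.

Definition swap (F : ps (ps K)) : ps (ps K) := fun m n => F n m.

Let swap_additive : additive swap.
Proof. by move=> F G; do 2!apply: funext => ?. Qed.
HB.instance Definition _ :=
  GRing.isAdditive.Build (ps (ps K)) (ps (ps K)) swap swap_additive.
Let swap_mul : monoid_morphism swap.
Proof.
split=> [|F G]; apply: psP => m; apply: psP => n.
  by case: m n => [|m] [|n].
rewrite /swap !psME !ps_sumE; under eq_bigr do rewrite psME.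
under [RHS]eq_bigr do rewrite psME.
by rewrite exchange_big.
Qed.
HB.instance Definition _ :=
  GRing.isMonoidMorphism.Build (ps (ps K)) (ps (ps K)) swap swap_mul.

End Diagonal.

Definition leibniz (K : comNzRingType) (T : K -> K) :=
  forall f g, T (f * g) = T f * g + f * T g.

(** Stands in for characteristic 0 when a differential equation is solved coefficient by
    coefficient. *)
Definition torsion_free (K : comNzRingType) :=
  forall (x : K) n, x *+ n.+1 = 0 -> x = 0.

Lemma torsion_free_inj (K : comNzRingType) (x y : K) n :
  torsion_free K -> x *+ n.+1 = y *+ n.+1 -> x = y.
Proof.
move=> tf xy; apply/eqP; rewrite -subr_eq0; apply/eqP/(tf _ n).
by rewrite mulrnBl xy subrr.
Qed.

Section PsDerivative.
Variable K : comNzRingType.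
Implicit Types (f g h : ps K).

Definition psderiv f : ps K := fun n => f n.+1 *+ n.+1.

Let psderiv_additive : additive psderiv.
Proof.
by move=> f g; apply: psP => n; rewrite psDE psNE /psderiv psDE psNE mulrnBl.
Qed.
HB.instance Definition _ :=
  GRing.isAdditive.Build (ps K) (ps K) psderiv psderiv_additive.

Lemma psderiv_leibniz : leibniz psderiv.
Proof.
move=> f g; apply: psP => n; rewrite psDE /psderiv psME.
have -> : (\sum_(i < n.+2) f i * g (n.+1 - i)%N) *+ n.+1 =
    \sum_(i < n.+2) (f i *+ i) * g (n.+1 - i)%N +
    \sum_(i < n.+2) f i * (g (n.+1 - i)%N *+ (n.+1 - i)).
  rewrite -sumrMnl -big_split /=; apply: eq_bigr => i _.
  by rewrite mulrnAl mulrnAr -mulrnDr subnKC // -ltnS.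
congr (_ + _).
  rewrite big_ord_recl mulr0n mul0r add0r psME.
  by apply: eq_bigr.
rewrite big_ord_recr /= subnn mulr0n mulr0 addr0 psME.
by apply: eq_bigr => i _; rewrite subSn // -ltnS.
Qed.

(** Chain rule for F(p, p): the first term differentiates in the inner variable, the second in the
    outer one. *)
Lemma psderiv_diag (F : ps (ps K)) :
  psderiv (diag F) = diag (psmap psderiv F) + diag (fun k => F k.+1 *+ k.+1).
Proof.
apply: psP => n; rewrite psDE /psderiv /diag.
have -> : (\sum_(k < n.+2) F k (n.+1 - k)%N) *+ n.+1 =
    \sum_(k < n.+2) F k (n.+1 - k)%N *+ (n.+1 - k) +
    \sum_(k < n.+2) F k (n.+1 - k)%N *+ k.
  rewrite -sumrMnl -big_split /=; apply: eq_bigr => i _.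
  by rewrite -mulrnDr subnK // -ltnS.
congr (_ + _).
  rewrite big_ord_recr /= subnn mulr0n addr0.
  by apply: eq_bigr => i _; rewrite /psmap subSn // -ltnS.
rewrite big_ord_recl mulr0n add0r.
by apply: eq_bigr => i _; rewrite ps_mulrnE.
Qed.

Lemma psderiv_eq0 f : torsion_free K -> psderiv f = 0 -> f = psC (f 0%N).
Proof.
move=> tf f0; apply: psP => -[|n] //=; apply: (tf _ n).
exact: (congr1 (@^~ n) f0).
Qed.

(** Both sides set all three variables equal; the left identifies the two outer ones first, the
    right the two inner ones. *)
Lemma diag_diag (F : ps (ps (ps K))) :
  diag (diag F) = diag (psmap (@diag K) F).
Proof.
apply: psP => n; elim: n F => [|n IHn] F.
  by rewrite /diag /psmap !big_ord1.
have -> : diag (diag F) = diag (F 0%N) + psX * diag (diag (tl F)).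
  apply: etrans (congr1 (@diag K) (diagE F)) _.
  apply: etrans (rmorphD (@diag K) _ _) _; congr (_ + _).
  by apply: etrans (rmorphM (@diag K) _ _) _; congr (_ * _); exact: diagX.
have -> : diag (psmap (@diag K) F) =
    diag (F 0%N) + psX * diag (psmap (@diag K) (tl F)) by exact: diagE.
by rewrite !psDE !psXMS IHn.
Qed.

Lemma diag_swap (F : ps (ps (ps K))) :
  diag (psmap (@diag K) F) = diag (psmap (@diag K) (swap F)).
Proof.
apply: psP => n; rewrite /diag /psmap /diag /swap.
rewrite (sum_triangle n (fun k l => F k l (n - k - l)%N)).
by apply: eq_bigr => l _; apply: eq_bigr => k _; rewrite subnAC.
Qed.

Lemma psmap_leibniz (T : {additive K -> K}) :
  leibniz T -> leibniz (psmap T).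
Proof.
move=> TM f g; apply: psP => n; rewrite psDE /psmap !psME.
rewrite raddf_sum -big_split /=.
by apply: eq_bigr => i _; rewrite TM.
Qed.

Lemma psmap_additive (T : {additive K -> K}) : additive (psmap T).
Proof. by move=> f g; apply: psP => n; rewrite psDE psNE /psmap -raddfB. Qed.

End PsDerivative.

(** * Formal flows of families of operators *)

Section Flow.
Variables (A : comNzRingType) (tfA : torsion_free A).
Variable D : nat -> {additive A -> A}.
Implicit Types (f g : A) (h : ps A).

(** The series sum_k p^k D_k h, right-hand side of the flow equation. *)
Definition dser h : ps A := diag (fun k => psmap (D k) h).

Lemma dserE h n : dser h n = \sum_(k < n.+1) D k (h (n - k)%N).
Proof. by []. Qed.

Lemma dser_additive : additive dser.
Proof.
move=> h h'; apply: etrans _ (raddfB (@diag A) _ _); congr diag.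
by apply: psP => k; rewrite psmap_additive.
Qed.

Lemma dser_leibniz : (forall k, leibniz (D k)) -> leibniz dser.
Proof.
move=> DM f g; rewrite /dser; have -> : (fun k => psmap (D k) (f * g)) =
    ((fun k => psmap (D k) f) : ps (ps A)) * psC g +
    psC f * ((fun k => psmap (D k) g) : ps (ps A)).
  by apply: psP => k; rewrite (psmap_leibniz (DM k)) psDE psCM psMC.
rewrite (rmorphD (@diag A)) !(rmorphM (@diag A)) /=.
by rewrite !diagC.
Qed.

(* The flow p |-> exp (sum_k D_k p^(k+1) / (k+1)), characterized by its
   differential equation in p. *)
Definition is_flow (phi : A -> ps A) :=
  (forall f, phi f 0%N = f) /\ (forall f, psderiv (phi f) = dser (phi f)).

(** The equation expresses (n + 1) h_(n+1) through h_0, ..., h_n, and absence of torsion recovers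
    h_(n+1). *)
Lemma flow_uniq h h' : psderiv h = dser h -> psderiv h' = dser h' ->
  h 0%N = h' 0%N -> h = h'.
Proof.
move=> hD hD' h0; apply: psP => n; elim/ltn_ind: n => -[//|n] IHn.
apply: (torsion_free_inj (n := n) tfA).
rewrite -[LHS]/(psderiv h n) -[RHS]/(psderiv h' n) hD hD' !dserE.
by apply: eq_bigr => k _; rewrite IHn // ltnS leq_subr.
Qed.

Variables (phi : A -> ps A) (phi_flow : is_flow phi).

(** An operator commuting with every D_k sends solutions to solutions, so uniqueness moves it
    through the flow. T will be a derivation or a coefficient of a second flow. *)
Lemma flow_commute (T : {additive A -> A}) f :
  (forall k g, D k (T g) = T (D k g)) -> phi (T f) = psmap T (phi f).
Proof.
have [phi0 phiD] := phi_flow; move=> TD.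
apply: flow_uniq => //; last by rewrite /psmap !phi0.
have -> : psderiv (psmap T (phi f)) = psmap T (psderiv (phi f)).
  by apply: psP => n; rewrite /psderiv /psmap raddfMn.
rewrite phiD; apply: psP => n; rewrite /psmap !dserE raddf_sum.
by apply: eq_bigr => k _; rewrite TD.
Qed.

Lemma flow_additive : additive phi.
Proof.
have [phi0 phiD] := phi_flow.
move=> f g; apply: flow_uniq; first exact: phiD.
  by rewrite (raddfB (@psderiv A)) /= !phiD dser_additive.
by rewrite psDE psNE !phi0.
Qed.

Lemma flow_mul : (forall k, leibniz (D k)) -> monoid_morphism phi.
Proof.
have [phi0 phiD] := phi_flow.
move=> DM; split=> [|f g]; apply: flow_uniq; rewrite ?phiD ?psM0 ?phi0 //.
  have D1 k : D k 1 = 0.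
    by apply: (addIr (D k 1)); rewrite add0r -[in RHS](mulr1 1) DM mulr1 mul1r.
  apply: psP => n; rewrite dserE big1 => [|k _]; first exact: mul0rn.
  by case: (n - k)%N => [|j]; [exact: D1 | exact: raddf0].
by rewrite dser_leibniz // psderiv_leibniz !phiD.
Qed.

End Flow.

Section FlowInverse.
Variables (A : comNzRingType) (tfA : torsion_free A).
Variable D : nat -> {additive A -> A}.
Variables phi psi : {additive A -> ps A}.
Hypothesis DC : forall k l f, D k (D l f) = D l (D k f).
Hypothesis phi_flow : is_flow (fun k => \- (D k)) phi.
Hypothesis psi_flow : is_flow D psi.

(** For Q(p', p) = psi_p (phi_p' f) the derivatives in p and p' are opposite on the diagonal because
    the D_k commute; hence Q(p, p) is constant. *)
Lemma flow_inverse f : diag (psmap psi (phi f)) = psC f.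
Proof.
have [[phi0 phiD] [psi0 psiD]] := (phi_flow, psi_flow).
pose Q : ps (ps A) := psmap psi (phi f).
pose R : ps (ps (ps A)) := fun j => psmap (psmap (D j)) Q.
have Q1 : psmap (@psderiv A) Q = psmap (@diag A) (swap R).
  by apply: psP => k; apply: psiD.
have Q2 : (fun k => Q k.+1 *+ k.+1) = - diag R.
  apply: psP => k; rewrite -[Q k.+1]/(psi (phi f k.+1)) -raddfMn.
  rewrite -[_ *+ _]/(psderiv (phi f) k) phiD dserE raddf_sum psNE /diag -sumrN.
  apply: eq_bigr => j _; rewrite raddfN /R /psmap /Q /psmap; congr (- _).
  by apply: (flow_commute tfA psi_flow) => l g; apply: DC.
rewrite (psderiv_eq0 tfA (f := diag Q)).
  by congr psC; rewrite /diag big_ord1 /Q /psmap psi0 phi0.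
have QQ : diag (psmap (@diag A) (swap R)) = diag (diag R).
  exact: etrans (esym (diag_swap R)) (esym (diag_diag R)).
apply: etrans (psderiv_diag Q) _; rewrite Q1 Q2 QQ.
by apply/eqP; rewrite addr_eq0; apply/eqP; rewrite -(raddfN (@diag A)) opprK.
Qed.

End FlowInverse.

Section Embeddings.
Variables K L : comNzRingType.

Lemma diag_psmapC (W : ps K) : diag (psmap (@psC K) W) = W.
Proof.
apply: psP => n; rewrite /diag big_ord_recr /= /psmap subnn big1 ?add0r //= => i _.
by have := ltn_ord i; rewrite -subn_gt0; case: (n - i)%N.
Qed.

Lemma swapK (F : ps (ps K)) : swap (swap F) = F. Proof. by []. Qed.

Lemma swap_psmapC (X : ps K) : swap (psmap (@psC K) X) = psC X.
Proof. by apply: psP => -[|m]; apply: psP => k; rewrite /swap /psmap. Qed.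

Lemma diag_psmap_psmap (g : {additive K -> L}) (F : ps (ps K)) :
  diag (psmap (psmap g) F) = psmap g (diag F).
Proof. by apply: psP => n; rewrite /psmap /diag raddf_sum. Qed.

Lemma psX_lreg : GRing.lreg (psX : ps K).
Proof. exact: psX_inj. Qed.

Lemma psC_lreg (c : K) : GRing.lreg c -> GRing.lreg (psC c).
Proof.
move=> c_reg f g fg; apply: psP => n; apply: c_reg.
by rewrite -!psCM fg.
Qed.

End Embeddings.

(* With P := x X and Q := y Y, the last three hypotheses become P - 1 = k Q,
   Q - 1 = k P and k (Q - P) = 0 for k := ci cj o1 o2, whence P = Q. *)
Lemma cocycle_algebra (K : comNzRingType)
    (x x' y y' X Xn Y Ym z1 z2 ci cj o1 o2 : K) :
  GRing.lreg ci -> GRing.lreg cj ->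
  x' * X = 1 -> x' * Xn = - (ci * o1) ->
  y' * Y = 1 -> y' * Ym = - (cj * o2) ->
  z1 = cj * o1 * y -> z2 = ci * o2 * x ->
  cj * (x * X - 1) + ci * (z1 * Ym) = 0 ->
  cj * (z2 * Xn) + ci * (y * Y - 1) = 0 ->
  cj * (x * Xn) + ci * (z1 * Y) = 0 ->
  x * y' = y * x'.
Proof.
move=> ci_reg cj_reg xX xXn yY yYm -> -> e1 e2 e3.
have {xXn} Xn_def : Xn = - (ci * o1 * X).
  by rewrite -[Xn]mul1r -xX mulrAC xXn mulNr.
have {yYm} Ym_def : Ym = - (cj * o2 * Y).
  by rewrite -[Ym]mul1r -yY mulrAC yYm mulNr.
subst Xn Ym; pose k := ci * cj * o1 * o2.
have {}e1 : x * X - 1 = k * (y * Y).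
  by apply: cj_reg; apply/eqP; rewrite -subr_eq0 -e1 /k; apply/eqP; ring.
have {}e2 : y * Y - 1 = k * (x * X).
  by apply: ci_reg; apply/eqP; rewrite -subr_eq0 -e2 /k; apply/eqP; ring.
have PQ : x * X = y * Y.
  rewrite -[LHS](subrK 1) -[RHS](subrK 1) e1 e2; congr (_ + _).
  apply/eqP; rewrite -subr_eq0 -[X in _ == X](mulr0 o2) -e3 /k.
  by apply/eqP; ring.
have -> : x * y' = (x * X) * (x' * y') by rewrite -[LHS]mulr1 -xX; ring.
rewrite PQ; have -> : y * x' = (y' * Y) * (y * x') by rewrite yY mul1r.
by ring.
Qed.

(** * Residues with at most two simple poles *)

Section DoubleResidue.
Variable A : comNzRingType.
Implicit Types (G f : nat -> ps (ps A)).

(* In ps (ps A) the outer variable is called q and the inner one p. *)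
Definition subst_inner G : ps (ps A) := fun m => diag (fun k => G k m).
Definition subst_outer G : ps (ps A) := diag (G : ps (ps (ps A))).

Lemma subst_innerE G :
  subst_inner G = G 0%N + psC psX * subst_inner (fun k => G k.+1).
Proof.
by apply: psP => m; rewrite psDE psCM /subst_inner [LHS]diagE.
Qed.

Lemma subst_outerE G :
  subst_outer G = G 0%N + psX * subst_outer (fun k => G k.+1).
Proof. exact: diagE. Qed.

Lemma subst_inner_swap G :
  subst_inner G = psmap (@diag A) (swap (G : ps (ps (ps A)))).
Proof. by []. Qed.

(* The residue in z of z^-1 (1 - p z)^-c (1 - q z)^-c' (sum_k G_k z^-k). *)
Definition residue2 (c c' : bool) G : ps (ps A) := fun m n =>
  \sum_(r < n.+1 | c || (r == 0%N :> nat))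
    \sum_(r' < m.+1 | c' || (r' == 0%N :> nat))
       G (r + r')%N (m - r')%N (n - r)%N.

Let sum_if n (c : bool) (B : nat -> A) :
  \sum_(r < n.+1 | c || (r == 0%N :> nat)) B r =
  if c then \sum_(r < n.+1) B r else B 0%N.
Proof.
case: c => //=; rewrite big_mkcond big_ord_recl /= big1 ?addr0 //.
Qed.

Lemma residue2_ff G : residue2 false false G = G 0%N.
Proof.
apply: psP => m; apply: psP => n; rewrite /residue2.
rewrite (sum_if n false (fun r => \sum_(r' < m.+1 | false || (r' == 0%N :> nat))
       G (r + r')%N (m - r')%N (n - r)%N)).
rewrite (sum_if m false (fun r' => G (0 + r')%N (m - r')%N (n - 0)%N)).
by rewrite !subn0.
Qed.

Lemma residue2_tf G : residue2 true false G = subst_inner G.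
Proof.
apply: psP => m; apply: psP => n; apply: eq_bigr => r _ /=.
rewrite (sum_if m false (fun r' => G (r + r')%N (m - r')%N (n - r)%N)).
by rewrite addn0 subn0.
Qed.

Lemma residue2_ft G : residue2 false true G = subst_outer G.
Proof.
apply: psP => m; apply: psP => n; rewrite /residue2.
rewrite (sum_if n false (fun r => \sum_(r' < m.+1)
       G (r + r')%N (m - r')%N (n - r)%N)) /subst_outer /diag ps_sumE.
by apply: eq_bigr => r' _; rewrite subn0.
Qed.

(** At q = 0 the factor 1 / (1 - q z) is 1, so the flag c' is immaterial. This extracts one-shift
    identities from two-shift ones. *)
Lemma residue2_coef0 c c' G : residue2 c c' G 0%N = residue2 c false G 0%N.
Proof.
apply: psP => n; apply: eq_bigr => r _.
rewrite (sum_if 0 c' (fun r' => G (r + r')%N (0 - r')%N (n - r)%N)).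
rewrite (sum_if 0 false (fun r' => G (r + r')%N (0 - r')%N (n - r)%N)).
by rewrite big_ord1 if_same.
Qed.

Lemma residue2_coef00 c c' G : residue2 c c' G 0%N 0%N = G 0%N 0%N 0%N.
Proof.
rewrite residue2_coef0; case: c; rewrite ?residue2_tf ?residue2_ff //.
exact: big_ord1.
Qed.

Let subst_inner_outer_var G :
  subst_inner (fun k => psX * G k) = psX * subst_inner G.
Proof.
apply: psP => -[|m]; rewrite ?psXM0 ?psXMS /subst_inner.
  by apply: psP => n; rewrite /diag big1 // => k _; rewrite psXM0.
by congr diag; apply: psP => k; rewrite psXMS.
Qed.

(* Partial fractions: (q - p) / ((1 - p z) (1 - q z)) =
   z^-1 (1 / (1 - q z) - 1 / (1 - p z)). *)
Lemma residue2_tt G :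
  (psX - psC psX) * residue2 true true (fun k => G k.+1) =
  subst_outer G - subst_inner G.
Proof.
(* [u r] is sum_r' q^r' G_(r+r'), so the residue is sum_r p^r u_(r+1); multiplied by p or by q it
   telescopes through u_r = G_r + q u_(r+1). *)
pose u r : ps (ps A) := subst_outer (fun r' => G (r + r')%N).
have uE r : u r = G r + psX * u r.+1.
  rewrite /u subst_outerE addn0; congr (_ + psX * subst_outer _).
  by apply/funext => r'; rewrite addnS.
have -> : residue2 true true (fun k => G k.+1) = subst_inner (fun r => u r.+1).
  apply: psP => m; apply: psP => n; apply: eq_bigr => r _ /=.
  rewrite /u /subst_outer /diag ps_sumE; apply: eq_bigr => r' _.
  by rewrite addSn.
have pE : psC psX * subst_inner (fun r => u r.+1) = subst_inner u - u 0%N.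
  by rewrite [subst_inner u]subst_innerE addrC addKr.
have qE : psX * subst_inner (fun r => u r.+1) = subst_inner u - subst_inner G.
  rewrite -subst_inner_outer_var.
  have -> : (fun k => psX * u k.+1) = (fun k => u k - G k).
    by apply/funext => k; rewrite (uE k) [RHS]addrC addKr.
  apply: psP => m; rewrite psDE psNE /subst_inner.
  by rewrite -(raddfB (@diag A)).
have -> : subst_outer G = u 0%N by [].
by rewrite mulrBl pE qE opprB addrC subrKA.
Qed.

End DoubleResidue.

(** * The bilinear identity with shifted times *)

Section FayIdentities.
Variables (A : comNzRingType) (N : nat).
Local Notation letter := (bool * 'I_N)%type.
Local Notation site := 'rV[int]_N.
Implicit Types (i j : letter) (s : site) (a b g : 'I_N).

(* The shift of s that accompanies the shift S_i of the times. *)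
Definition estep i : site := if i.1 then delta_mx 0 i.2 else 0.

(** Negative indices give 0, which kills the terms of the bilinear identity with a negative exponent
    [bexp]. *)
Definition coefz (h : ps A) (k : int) : A := if k is Posz n then h n else 0.

(* For equal times, the i-th term of the bilinear identity is the coefficient of
   z^-e in the product of the series W and W' below, for e = bexp i s s'. *)
Definition bexp i s s' : int :=
  if i.1 then s' 0 i.2 - s 0 i.2 - 1 else s 0 i.2 - s' 0 i.2 + 1.

Variable phi : letter -> {rmorphism A -> ps A}.
Hypothesis phi0 : forall i f, phi i f 0%N = f.
Hypothesis phiC : forall i j f m n,
  phi i (phi j f m) n = phi j (phi i f n) m.

Variables (W : site -> 'I_N -> letter -> ps A).
Variables (W' : site -> letter -> 'I_N -> ps A).
Hypothesis W0 : forall s a g, W s a (false, g) 0%N = (a == g)%:R.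
Hypothesis W'0 : forall s a g, W' s (false, g) a 0%N = (g == a)%:R.

(** Evaluation at z^-1 = p together with the shift S_i(p) of the times, for the same p: this is what
    the residue at the pole z = 1/p produces. *)
Definition hat i (h : ps A) : ps A := diag (psmap (phi i) h).

(** The coefficient of z^-k in W(z) times the doubly shifted W'(z); the outer variable q belongs to
    j0, the inner variable p to i0. *)
Definition bterm i0 j0 s s' a b i (k : int) : ps (ps A) := fun m n =>
  coefz (W s a i * (fun l => phi i0 (phi j0 (W' s' i b l) m) n)) k.

(** A shift contributes a pole only to the term of its own letter. With c = false the pole of j0 is
    dropped, as happens at q = 0. *)
Definition bres (c : bool) i0 j0 s s' a b i : ps (ps A) :=
  residue2 (i == i0) (c && (i == j0))
    (fun r => bterm i0 j0 s s' a b i (bexp i s s' + r%:Z)).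

(* The bilinear identity between (s, t) and (s', t'), with t' obtained from t by
   the shifts S_i0(p) and S_j0(q). *)
Hypothesis master : forall i0 j0 s s' a b,
  \sum_g bres true i0 j0 s s' a b (false, g) =
  \sum_g bres true i0 j0 s s' a b (true, g).

Section Terms.
Variables (i0 j0 : letter) (s s' : site) (a b : 'I_N).
Local Notation F := (bterm i0 j0 s s' a b).
Local Notation Fnat i := (fun k : nat => F i k%:Z).

Lemma bterm_prod i : Fnat i =
  psmap (@psC _) (psmap (@psC _) (W s a i)) *
  ((fun l => psmap (phi i0) (phi j0 (W' s' i b l))) : ps (ps (ps A))).
Proof.
apply: psP => k; apply: psP => m; apply: psP => n.
rewrite [RHS](congr1 (fun h : ps (ps A) => h m n) (psME _ _ _)) !ps_sumE.
apply: etrans (psME _ _ k) _.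
by apply: eq_bigr => l _; rewrite /psmap !psCM.
Qed.

(** S_j(q) applied to a series in p; [swap] puts q in the outer position. *)
Definition shift2 j (h : ps A) : ps (ps A) := swap (psmap (phi j) h).

Lemma subst_inner_bterm i :
  subst_inner (Fnat i) = psC (W s a i) * shift2 j0 (hat i0 (W' s' i b)).
Proof.
rewrite bterm_prod subst_inner_swap !rmorphM /=; congr (_ * _).
  by rewrite swap_psmapC psmapC /= diag_psmapC.
apply: psP => m; apply: psP => n; rewrite /shift2 /swap /psmap /hat /diag.
rewrite !rmorph_sum ps_sumE; apply: eq_bigr => k _.
by rewrite phiC.
Qed.

Lemma subst_outer_bterm i :
  subst_outer (Fnat i) =
  psmap (@psC _) (W s a i) * psmap (phi i0) (hat j0 (W' s' i b)).
Proof.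
rewrite bterm_prod /subst_outer rmorphM /=; congr (_ * _).
  exact: diag_psmapC.
by rewrite -diag_psmap_psmap.
Qed.

Lemma bterm_neg i k : F i (Negz k) = 0.
Proof. by []. Qed.

Lemma bterm0 g : F (false, g) 0 = ((a == g) && (g == b))%:R.
Proof.
apply: psP => m; apply: psP => n.
apply: etrans (psM0 _ _) _; rewrite W0 W'0 !rmorph_nat.
case: (a == g); case: (g == b); rewrite ?mul0r ?mulr0 ?mul1r //=.
all: exact: (congr1 (fun h : ps (ps A) => h m n)
  (rmorph_nat (psmap (phi i0)) _)).
Qed.

Lemma bterm1 g : F (false, g) 1 =
  (a == g)%:R * psmap (phi i0) (phi j0 (W' s' (false, g) b 1%N)) +
  psC (psC (W s a (false, g) 1%N)) * (g == b)%:R.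
Proof.
apply: etrans (congr1 (@^~ 1%N) (bterm_prod (false, g))) _.
rewrite psMS [X in _ + X]psM0 /psmap W0 !rmorph_nat; congr (_ + _ * _).
by rewrite /tl W'0 rmorph_nat; apply: (rmorph_nat (psmap (phi i0))).
Qed.

Lemma sum_delta (K : comNzRingType) (P : pred 'I_N) (X : 'I_N -> K) c :
  \sum_(g | P g) (c == g)%:R * X g = (P c)%:R * X c.
Proof.
rewrite big_mkcond (bigD1 c) //= eqxx big1 => [|g].
  by rewrite addr0; case: ifP => _; rewrite ?mul1r ?mul0r.
by rewrite eq_sym => /negPf->; rewrite mul0r if_same.
Qed.

Lemma sum_bterm1 (P : pred 'I_N) :
  \sum_(g | P g) F (false, g) 1 =
  (P a)%:R * psmap (phi i0) (phi j0 (W' s' (false, a) b 1%N)) +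
  (P b)%:R * psC (psC (W s a (false, b) 1%N)).
Proof.
rewrite -(sum_delta P
  (fun g => psmap (phi i0) (phi j0 (W' s' (false, g) b 1%N))) a).
rewrite -(sum_delta P (fun g => psC (psC (W s a (false, g) 1%N))) b).
rewrite -big_split /=; apply: eq_bigr => g _.
by rewrite bterm1 [X in _ + X]mulrC [g == b]eq_sym.
Qed.

(** The factor that turns a block with one pole into W W' minus its leading term: p clears the
    denominator in the unbarred case, and -1 corrects the sign of a barred term, which stands on the
    subtracted side. *)
Definition cvar (K : comNzRingType) i : ps K := if i.1 then - 1 else psX.

Definition block c g : ps (ps A) :=
  bres c i0 j0 s s' a b (false, g) - bres c i0 j0 s s' a b (true, g).

Let bterm_succ i :
  (fun r : nat => F i (1 + r%:Z)) = (fun r => F i (r.+1)%:Z).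
Proof. by apply/funext => r; rewrite intS. Qed.

Let bterm_zero i : (fun r : nat => F i (0 + r%:Z)) = (fun r => F i r%:Z).
Proof. by apply/funext => r; rewrite add0r. Qed.

(** Without a pole and with s'_g = s_g the unbarred exponent is 1 and the barred one is -1, so only
    the coefficient of z^-1 of the unbarred product survives. *)
Lemma block_other (c : bool) g :
  g != i0.2 -> (c -> g != j0.2) -> s' 0 g = s 0 g ->
  block c g = F (false, g) 1.
Proof.
move=> gi gj ss.
have ne d : ((d, g) == i0) = false by apply: contraNF gi => /eqP <-.
have nej d : (c && ((d, g) == j0)) = false.
  by case: c gj => //= /(_ isT) gj; apply: contraNF gj => /eqP <-.
rewrite /block /bres !ne !nej !residue2_ff /bexp /= ss subrr add0r addr0.
by rewrite [F (true, g) _](_ : _ = 0) ?subr0.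
Qed.

(** In the unbarred case the residue is (G(p) - G_0) / p. In the barred case the shift of s sets
    both exponents to 0: the residue is G(p), and the leading term is supplied by the unbarred term
    of the same index. *)
Lemma block_inner (c : bool) :
  (c -> i0.2 != j0.2) -> s' 0 i0.2 = s 0 i0.2 + i0.1%:Z ->
  psC (cvar A i0) * block c i0.2 =
  psC (W s a i0) * shift2 j0 (hat i0 (W' s' i0 b))
  - ((a == i0.2) && (i0.2 == b))%:R.
Proof.
move=> ij ss; rewrite -subst_inner_bterm -bterm0.
have nej d : (c && ((d, i0.2) == j0)) = false.
  by case: c ij => //= /(_ isT) ij; apply: contraNF ij => /eqP <-.
case E: i0 ss nej => [[] g] /= ss nej; rewrite /block /bres /cvar /= !nej -E.
- have -> : ((false, g) == i0) = false by rewrite E.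
  rewrite eqxx.
  have -> : bexp (false, g) s s' = 0 by rewrite /bexp /= ss; lia.
  have -> : bexp i0 s s' = 0 by rewrite E /bexp /= ss; lia.
  by rewrite residue2_tf residue2_ff !bterm_zero E rmorphN1 mulN1r opprB.
- have -> : ((true, g) == i0) = false by rewrite E.
  rewrite eqxx.
  have -> : bexp i0 s s' = 1 by rewrite E /bexp /= ss; lia.
  have -> : bexp (true, g) s s' = - 1 by rewrite /bexp /= ss; lia.
  rewrite residue2_tf residue2_ff bterm_succ subr0 E.
  by rewrite [X in _ = X - _]subst_innerE [RHS]addrC addKr.
Qed.

Lemma block_outer : i0.2 != j0.2 -> s' 0 j0.2 = s 0 j0.2 + j0.1%:Z ->
  cvar (ps A) j0 * block true j0.2 =
  psmap (@psC _) (W s a j0) * psmap (phi i0) (hat j0 (W' s' j0 b))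
  - ((a == j0.2) && (j0.2 == b))%:R.
Proof.
move=> ij ss; rewrite -subst_outer_bterm -bterm0.
have nej d : ((d, j0.2) == i0) = false.
  by apply: contraNF ij => /eqP <-.
case E: j0 ss nej => [[] g] /= ss nej; rewrite /block /bres /cvar /= !nej -E.
- have -> : ((false, g) == j0) = false by rewrite E.
  rewrite eqxx.
  have -> : bexp (false, g) s s' = 0 by rewrite /bexp /= ss; lia.
  have -> : bexp j0 s s' = 0 by rewrite E /bexp /= ss; lia.
  by rewrite residue2_ft residue2_ff !bterm_zero E mulN1r opprB.
- have -> : ((true, g) == j0) = false by rewrite E.
  rewrite eqxx.
  have -> : bexp j0 s s' = 1 by rewrite E /bexp /= ss; lia.
  have -> : bexp (true, g) s s' = - 1 by rewrite /bexp /= ss; lia.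
  rewrite residue2_ft residue2_ff bterm_succ subr0 E.
  by rewrite [X in _ = X - _]subst_outerE [RHS]addrC addKr.
Qed.

End Terms.

Lemma estepE i s g : (s + estep i) 0 g = s 0 g + (i.1 && (g == i.2))%:Z.
Proof.
rewrite mxE; congr (_ + _); case: i => [[] h]; rewrite /estep !mxE //.
by rewrite eqxx /=; case: (g == h).
Qed.

Lemma sum_block i0 j0 s s' a b : \sum_g block i0 j0 s s' a b true g = 0.
Proof. by rewrite sumrB master subrr. Qed.

Lemma sum_block0 i0 j0 s s' a b :
  \sum_g block i0 j0 s s' a b false g 0%N = 0.
Proof.
rewrite -[RHS](congr1 (@^~ 0%N) (sum_block i0 j0 s s' a b)) ps_sumE.
apply: eq_bigr => g _; rewrite /block !psDE !psNE /bres.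
by congr (_ - _); rewrite [RHS]residue2_coef0.
Qed.

(** The bilinear identity at equal times and s' = s, that is p = q = 0, where the choice of the
    letter [i] is immaterial. *)
Lemma W1_adj s a b : W' s (false, a) b 1%N = - W s a (false, b) 1%N.
Proof.
apply/eqP; rewrite -addr_eq0; apply/eqP; pose i : letter := (true, a).
transitivity ((\sum_(g | predT g) bterm i i s s a b (false, g) 1) 0%N 0%N).
  rewrite sum_bterm1 !mul1r !psDE /psmap.
  by rewrite !phi0.
rewrite -[RHS](congr1 (fun h : ps (ps A) => h 0%N 0%N) (sum_block i i s s a b)).
rewrite !ps_sumE; apply: eq_bigr => g _; rewrite /block !psDE !psNE /bres.
rewrite !residue2_coef00 /bexp /= subrr add0r addr0.
by rewrite [bterm i i s s a b (true, g) _](_ : _ = 0) ?subr0.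
Qed.

(** The case q = 0: the block of index [i.2] gives the product on the left, every other block a
    coefficient of z^-1. *)
Lemma one_parameter i s a b :
  W s a i * hat i (W' (s + estep i) i b) =
  ((a == i.2) && (i.2 == b))%:R
  - cvar A i * ((a != i.2)%:R * phi i (W' (s + estep i) (false, a) b 1%N)
                + (b != i.2)%:R * psC (W s a (false, b) 1%N)).
Proof.
set s' := s + estep i; have ss : s' 0 i.2 = s 0 i.2 + i.1%:Z.
  by rewrite estepE eqxx andbT.
have := sum_block0 i i s s' a b; rewrite (bigD1 i.2) //= => H.
have {}H := congr1 (fun h => cvar A i * h) H.
rewrite mulr0 mulrDr -psCM block_inner // psDE psCM psNE in H.
have coef_nat (k : nat) : (k%:R : ps (ps A)) 0%N = k%:R.
  by rewrite -[X in X 0%N](rmorph_nat (@psC (ps A))).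
rewrite coef_nat in H.
have HW : shift2 i (hat i (W' s' i b)) 0%N = hat i (W' s' i b).
  by apply: psP => n; apply: phi0.
rewrite HW in H; apply/eqP; rewrite -subr_eq0 opprB addrA addrAC -H.
apply/eqP; congr (_ + _ * _).
transitivity ((\sum_(g | g != i.2) bterm i i s s' a b (false, g) 1) 0%N).
  rewrite sum_bterm1 psDE -[((a != _)%:R : ps (ps A))](rmorph_nat (@psC _)).
  rewrite -[((b != _)%:R : ps (ps A))](rmorph_nat (@psC _)) !psCM.
  congr (_ * _ + _); apply: psP => n; rewrite /psmap.
  by rewrite phiC phi0.
rewrite ps_sumE; apply: eq_bigr => g gi.
by rewrite (block_other (j0 := i)) // estepE (negPf gi) andbF addr0.
Qed.

(** For distinct indices each of the two blocks has one pole. With a and b among these indices the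
    other blocks vanish, since a block without poles needs g = a or g = b. *)
Lemma two_parameters_neq i j s a b :
  i.2 != j.2 -> a \in [:: i.2; j.2] -> b \in [:: i.2; j.2] ->
  let s' := s + estep i + estep j in
  cvar (ps A) j *
    (psC (W s a i) * shift2 j (hat i (W' s' i b))
     - ((a == i.2) && (i.2 == b))%:R) +
  psC (cvar A i) *
    (psmap (@psC _) (W s a j) * psmap (phi i) (hat j (W' s' j b))
     - ((a == j.2) && (j.2 == b))%:R) = 0.
Proof.
move=> ij ai bi s'.
have ss g : s' 0 g = s 0 g + (i.1 && (g == i.2))%:Z + (j.1 && (g == j.2))%:Z.
  by rewrite !estepE.
have si : s' 0 i.2 = s 0 i.2 + i.1%:Z.
  by rewrite ss eqxx (negPf ij) andbT andbF addr0.
have sj : s' 0 j.2 = s 0 j.2 + j.1%:Z.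
  by rewrite ss eqxx eq_sym (negPf ij) andbT andbF addr0.
have := sum_block i j s s' a b.
have ji : j.2 != i.2 by rewrite eq_sym.
rewrite (bigD1 i.2) //= (bigD1 j.2) //= [X in _ + (_ + X)](_ : _ = 0).
  rewrite addr0 => H; rewrite -(@block_inner i j s s' a b true) //.
  rewrite -(@block_outer i j s s' a b) //.
  by rewrite mulrCA -!mulrDr H !mulr0.
rewrite (eq_bigr (fun g => bterm i j s s' a b (false, g) 1)); last first.
  move=> g /andP[gi gj]; apply: block_other => //.
  by rewrite ss (negPf gi) (negPf gj) !andbF !addr0.
rewrite sum_bterm1; move: ai bi; rewrite !inE /=.
by move=> /orP[] /eqP -> /orP[] /eqP ->; rewrite !eqxx ?andbF !mul0r addr0.
Qed.

(** For letters of the same kind both poles fall on one side, the other side vanishes by its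
    negative exponent, and partial fractions apply. For letters of different kinds each side has one
    pole, at exponent 0. *)
Lemma residue2_flip (F : letter -> int -> ps (ps A)) i j : i.2 = j.2 ->
  (forall k n, F k (Negz n) = 0) ->
  residue2 ((false, i.2) == i) ((false, i.2) == j)
    (fun r => F (false, i.2) (1 - i.1%:Z - j.1%:Z + r%:Z)) =
  residue2 ((true, i.2) == i) ((true, i.2) == j)
    (fun r => F (true, i.2) (i.1%:Z + j.1%:Z - 1 + r%:Z)) ->
  subst_inner (fun k => F i k%:Z) = subst_outer (fun k => F j k%:Z).
Proof.
move=> ij Fneg.
have tt G : residue2 true true (fun k => G k.+1) = 0 ->
    subst_inner G = subst_outer G :> ps (ps A).
  move=> G0; apply/esym/eqP; rewrite -subr_eq0 -residue2_tt G0.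
  by rewrite mulr0.
case: i j ij => [c g] [c' g'] /= <-; rewrite !xpair_eqE eqxx !andbT.
have zero k : (fun r : nat => F k (0 + r%:Z)) = (fun r => F k r%:Z).
  by apply/funext => r; rewrite add0r.
have one k : (fun r : nat => F k (1 + r%:Z)) = (fun r => F k (r.+1)%:Z).
  by apply/funext => r; rewrite intS.
case: c; case: c' => /=.
- rewrite residue2_ff (_ : 1%:Z + 1%:Z - 1 = 1) // one.
  rewrite [F _ _](Fneg _ 0%N) !eqxx => /esym E.
  exact: (tt (fun k => F (true, g) k%:Z) E).
- rewrite residue2_ft residue2_tf (_ : 1 - 1%:Z - 0%:Z = 0) ?subrr //.
- rewrite residue2_ft residue2_tf (_ : 1 - 0%:Z - 1%:Z = 0) ?subr0 ?subrr //.
- rewrite residue2_ff (_ : 1 - 0%:Z - 0%:Z = 1) // one.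
  rewrite [F _ _](Fneg _ 0%N) !eqxx => E.
  exact: (tt (fun k => F (false, g) k%:Z) E).
Qed.

Lemma two_parameters_eq i j s : i.2 = j.2 ->
  let s' := s + estep i + estep j in
  psC (W s i.2 i) * shift2 j (hat i (W' s' i i.2)) =
  psmap (@psC _) (W s i.2 j) * psmap (phi i) (hat j (W' s' j i.2)).
Proof.
move=> ij s'; rewrite -subst_inner_bterm -subst_outer_bterm.
have ss g : s' 0 g = s 0 g + (i.1 && (g == i.2))%:Z + (j.1 && (g == j.2))%:Z.
  by rewrite !estepE.
have := sum_block i j s s' i.2 i.2.
rewrite (bigD1 i.2) //= [X in _ + X](_ : _ = 0) ?addr0.
  move=> /eqP; rewrite subr_eq0 => /eqP.
  have bexpE c : bexp (c, i.2) s s' =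
      if c then i.1%:Z + j.1%:Z - 1 else 1 - i.1%:Z - j.1%:Z.
    rewrite /bexp /= ss -ij eqxx !andbT; case: c; lia.
  rewrite /bres !bexpE => E.
  by apply: (residue2_flip ij (fun k n => bterm_neg _ _ _ _ _ _ k n)); exact: E.
rewrite (eq_bigr (fun g => bterm i j s s' i.2 i.2 (false, g) 1)); last first.
  move=> g gi; apply: block_other => //; rewrite -?ij //.
  by rewrite ss -ij (negPf gi) !andbF !addr0.
by rewrite sum_bterm1 eqxx !mul0r addr0.
Qed.

(** This provides the inverse v_i of u_i as a power series. *)
Lemma W_inv i s : W s i.2 i * hat i (W' (s + estep i) i i.2) = 1.
Proof.
by rewrite one_parameter !eqxx /= !mul0r addr0 mulr0 subr0.
Qed.

Lemma W'_off i s b : b != i.2 ->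
  W s i.2 i * hat i (W' (s + estep i) i b) =
  - (cvar A i * psC (W s i.2 (false, b) 1%N)).
Proof.
move=> bi; rewrite one_parameter !eqxx [i.2 == b]eq_sym (negPf bi) /=.
by rewrite mul0r mul1r !add0r.
Qed.

(** [W_inv] allows the adjoint factor to be divided out of [one_parameter], and [W1_adj] trades the
    remaining coefficient of W' for one of W. *)
Lemma W_off i s a : a != i.2 ->
  W s a i =
  cvar A i * phi i (W (s + estep i) a (false, i.2) 1%N) * W s i.2 i.
Proof.
move=> ai; rewrite -[LHS]mulr1 -(W_inv i s) mulrCA mulrC; congr (_ * _).
rewrite one_parameter eqxx (negPf ai) /= mul0r mul1r addr0 W1_adj.
by rewrite rmorphN mulrN opprK add0r.
Qed.

Lemma shift2M j : {morph shift2 j : h h' / h * h'}.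
Proof. by move=> h h'; rewrite /shift2 !rmorphM. Qed.

Lemma shift2_1 j : shift2 j 1 = 1.
Proof. by rewrite /shift2 !rmorph1. Qed.

Lemma shift2N j h : shift2 j (- h) = - shift2 j h.
Proof. by rewrite /shift2 !rmorphN. Qed.

Lemma swap_psC (K : comNzRingType) (h : ps K) : swap (psC h) = psmap (@psC K) h.
Proof. by rewrite -(swap_psmapC h) swapK. Qed.

Lemma shift2C j f : shift2 j (psC f) = psmap (@psC A) (phi j f).
Proof. by rewrite /shift2 psmapC swap_psC. Qed.

Lemma shift2_cvar j i : shift2 j (cvar A i) = psC (cvar A i).
Proof.
rewrite /cvar /shift2; case: i.1; first by rewrite !rmorphN1.
rewrite psmapX -[psX in LHS](psmapX (@psC A)).
by rewrite swap_psmapC.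
Qed.

Lemma cvar_psmap (g : {rmorphism A -> ps A}) i :
  psmap g (cvar A i) = cvar (ps A) i.
Proof. by rewrite /cvar; case: i.1; rewrite ?psmapX // !rmorphN1. Qed.

(** [cocycle_algebra] has to cancel p, which is regular but not a unit. *)
Lemma cvar_lreg (K : comNzRingType) i : GRing.lreg (cvar K i).
Proof.
rewrite /cvar; case: i.1; last exact: psX_lreg.
by move=> x y; rewrite !mulN1r => /oppr_inj.
Qed.

Lemma cross_mul (K : comNzRingType) (x x' y y' X Y : K) :
  x' * X = 1 -> y' * Y = 1 -> x * X = y * Y -> x * y' = y * x'.
Proof.
move=> xX yY E; rewrite -[LHS]mulr1 -xX.
have -> : x * y' * (x' * X) = x * X * (x' * y') by ring.
by rewrite E -[RHS]mulr1 -yY; ring.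
Qed.

(** For equal indices the two-shift identity gives the relation at once; for distinct ones the
    off-diagonal entries are eliminated by [W_off] and [W'_off]. *)
Lemma fay_cocycle i j s :
  psC (W s i.2 i) * psmap (phi i) (W (s + estep i) j.2 j) =
  psmap (@psC _) (W s j.2 j) * shift2 j (W (s + estep j) i.2 i).
Proof.
set s' := s + estep i + estep j.
have s'E : s + estep j + estep i = s' by rewrite /s' addrAC.
have Ei := W_inv i (s + estep j); have Ej := W_inv j (s + estep i).
rewrite s'E in Ei; rewrite -/s' in Ej.
move/(congr1 (shift2 j)): Ei; rewrite shift2M shift2_1 => Ei.
move/(congr1 (psmap (phi i))): Ej; rewrite rmorphM rmorph1 /= => Ej.
have [ij | ij] := eqVneq i.2 j.2.
  have := two_parameters_eq s ij; rewrite /= -/s' ij => E.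
  rewrite ij in Ei.
  exact: cross_mul Ei Ej E.
have ji : j.2 != i.2 by rewrite eq_sym.
have Fi := W'_off (s + estep j) ji; have Fj := W'_off (s + estep i) ij.
rewrite s'E in Fi; rewrite -/s' in Fj.
move/(congr1 (shift2 j)): Fi.
rewrite shift2M shift2N shift2M shift2_cvar shift2C => Fi.
move/(congr1 (psmap (phi i))): Fj.
rewrite rmorphM rmorphN rmorphM /= cvar_psmap psmapC => Fj.
have Gi := congr1 (@psC _) (W_off s ji).
rewrite !rmorphM /= in Gi.
have Gj := congr1 (psmap (@psC A)) (W_off s ij).
rewrite !rmorphM /= cvar_psmap in Gj.
have im : i.2 \in [:: i.2; j.2] by rewrite inE eqxx.
have jm : j.2 \in [:: i.2; j.2] by rewrite !inE eqxx orbT.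
(* The entries (i, i), (j, j) and (i, j) of the two-shift identity. *)
have e1 := two_parameters_neq s ij im im.
have e2 := two_parameters_neq s ij jm jm.
have e3 := two_parameters_neq s ij im jm.
rewrite /= -/s' !eqxx (negPf ij) ?(negPf ji) /= !subr0 in e1 e2 e3.
apply: (cocycle_algebra (psC_lreg (@cvar_lreg A i)) (@cvar_lreg (ps A) j)
  Ei Fi Ej Fj Gj Gi e1 e2 e3).
Qed.

End FayIdentities.

Lemma mulrI_inv (K : comNzRingType) (c w x y : K) :
  c * w = 1 -> c * x = c * y -> x = y.
Proof.
move=> cw cxy; rewrite -[x]mul1r -[y]mul1r -cw.
by rewrite -!mulrA ![w * _]mulrC !mulrA cxy.
Qed.

Section FlowDerivation.
Variables (A : comNzRingType) (D : nat -> {additive A -> A}).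

(* A power series killed by [flowder] is the image of its constant term under
   the flow of - D. *)
Definition flowder (h : ps A) : ps A := psderiv h + dser D h.

Let flowder_additive : additive flowder.
Proof.
move=> h h'; rewrite /flowder raddfB dser_additive /=.
by rewrite opprD addrACA.
Qed.
HB.instance Definition _ :=
  GRing.isAdditive.Build (ps A) (ps A) flowder flowder_additive.

Lemma flowder_leibniz : (forall k, leibniz (D k)) -> leibniz flowder.
Proof.
move=> DM h h'; rewrite /flowder psderiv_leibniz dser_leibniz // mulrDl mulrDr.
by rewrite addrACA.
Qed.

Lemma flowderC f : flowder (psC f) = (fun k => D k f).
Proof.
apply: psP => n; rewrite /flowder psDE dserE big_ord_recr /= subnn.
rewrite [psderiv _ _]mul0rn add0r big1 ?add0r // => i _.
by have := ltn_ord i; rewrite -subn_gt0; case: (n - i)%N => //= m _; rewrite raddf0.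
Qed.

Lemma flowder_eq0 h : (flowder h = 0) <-> psderiv h = dser (fun k => \- (D k)) h.
Proof.
have -> : dser (fun k => \- (D k)) h = - dser D h.
  by apply: psP => n; rewrite psNE !dserE -sumrN.
rewrite /flowder; split=> [/eqP | ->]; last exact: addNr.
by rewrite addr_eq0 => /eqP.
Qed.

Lemma flowder_commute (T : {additive A -> A}) h :
  (forall k f, D k (T f) = T (D k f)) ->
  flowder (psmap T h) = psmap T (flowder h).
Proof.
move=> TD; apply: psP => n; rewrite /psmap /flowder !psDE raddfD /psderiv raddfMn.
by rewrite !dserE raddf_sum; congr (_ + _); apply: eq_bigr => k _; rewrite TD.
Qed.

End FlowDerivation.

(** * The equations for the tau function *)

Section TauEquations.
Variables (A : comNzRingType) (tfA : torsion_free A) (N : nat).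
Local Notation letter := (bool * 'I_N)%type.
Local Notation site := 'rV[int]_N.
Implicit Types (i j : letter) (s : site).

Variable d : letter -> nat -> {additive A -> A}.
Hypothesis dM : forall i k, leibniz (d i k).
Hypothesis dC : forall i j k l f, d i k (d j l f) = d j l (d i k f).
Variable phi : letter -> {rmorphism A -> ps A}.
Hypothesis phi_flow : forall i, is_flow (fun k => \- (d i k)) (phi i).

Variables u v : letter -> site -> ps A.
Hypothesis uv : forall i s, u i s * v i s = 1.
Hypothesis cocycle : forall i j s,
  psC (u i s) * psmap (phi i) (u j (s + estep i)) =
  psmap (@psC _) (u j s) * shift2 phi j (u i (s + estep j)).

Definition dlog_u i s : ps A := flowder (d i) (u i s) * v i s.

(* The value that [tau_shift] imposes on d i k (log tau). *)
Definition dlog_tau i k s : A := - dlog_u i s k.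

Lemma phi_d i j k f : phi i (d j k f) = psmap (d j k) (phi i f).
Proof.
apply: (flow_commute tfA (phi_flow i)) => l g.
by rewrite [LHS](congr1 -%R (dC _ _ _ _ _)) [RHS]raddfN.
Qed.

Lemma flowder_phi i f : flowder (d i) (phi i f) = 0.
Proof. by apply/flowder_eq0; have [_ ->] := phi_flow i. Qed.

Lemma flowder_u i s : flowder (d i) (u i s) = u i s * dlog_u i s.
Proof. by rewrite mulrCA uv mulr1. Qed.

Lemma flowder_shift2 i j h :
  psmap (flowder (d i)) (shift2 phi j h) = shift2 phi j (flowder (d i) h).
Proof.
apply: psP => m; apply: psP => n.
rewrite -[LHS]/(phi j (h n.+1) m *+ n.+1 +
  \sum_(k < n.+1) d i k (phi j (h (n - k)%N) m)).
rewrite -[RHS]/(phi j (h n.+1 *+ n.+1 +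
  \sum_(k < n.+1) d i k (h (n - k)%N)) m).
rewrite rmorphD rmorphMn rmorph_sum psDE ps_mulrnE ps_sumE.
by congr (_ + _); apply: eq_bigr => k _; rewrite phi_d.
Qed.

(** Logarithmic derivative of the cocycle along [flowder (d i)], acting in p: S_i(p) u_j(q) is
    killed, and u_j(q), being free of p, contributes sum_k p^k d_(i,k) log u_j(q), which is [L]. *)
Lemma dlog_tau_shift i j k s :
  phi j (dlog_tau i k (s + estep j)) =
  psC (dlog_tau i k s) + psmap (d i k) (u j s) * v j s.
Proof.
pose L : ps (ps A) := swap (fun n => psmap (d i n) (u j s) * v j s).
set s1 := s + estep j.
have key : psC (dlog_u i s) = L + shift2 phi j (dlog_u i s1).
  pose y := psmap (@psC A) (u j s); pose x' := shift2 phi j (u i s1).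
  pose w := psmap (@psC A) (v j s) * shift2 phi j (v i s1).
  have yxw : y * x' * w = 1.
    by rewrite mulrACA -rmorphM uv rmorph1 -shift2M uv shift2_1 mulr1.
  have yL : y * L = psmap (flowder (d i)) y.
    apply: (can_inj (@swapK A)); rewrite rmorphM /=.
    rewrite [X in X * _]swap_psmapC; apply: psP => n.
    rewrite psCM mulrCA uv mulr1; apply: psP => m.
    by rewrite /swap /psmap flowderC.
  have cross : y * x' * psC (dlog_u i s) =
      y * x' * (L + shift2 phi j (dlog_u i s1)).
    have Tmap := psmap_leibniz (flowder_leibniz (dM i)).
    have := congr1 (psmap (flowder (d i))) (cocycle i j s).
    rewrite !Tmap flowder_shift2 flowder_u shift2M -yL.
    have -> : psmap (flowder (d i)) (psC (u i s)) =
        psC (u i s) * psC (dlog_u i s).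
      rewrite -rmorphM -flowder_u; apply: psP => -[|m] //.
      exact: raddf0.
    have -> : psmap (flowder (d i)) (psmap (phi i) (u j (s + estep i))) = 0.
      by apply: psP => m; apply: flowder_phi.
    rewrite mulr0 addr0 mulrAC cocycle -/y -/x' => ->.
    by rewrite mulrDr mulrAC mulrA.
  exact: mulrI_inv yxw cross.
apply: psP => m; rewrite psDE /dlog_tau rmorphN psNE.
have := congr1 (fun F : ps (ps A) => F m k) key.
rewrite !psDE -[L m k]/((psmap (d i k) (u j s) * v j s) m).
rewrite -[shift2 _ _ _ _ _]/(phi j (dlog_u i s1 k) m).
move=> E; have -> : psC (- dlog_u i s k) m = - psC (dlog_u i s) m k.
  by case: (m) => // n; rewrite oppr0.
by rewrite E opprD addrAC addNr add0r.
Qed.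

(** Under [flowder (d j)] the left side of [dlog_tau_shift] dies, and d_(i,k) log u_j becomes
    d_(i,k) of [dlog_u j], whose coefficients are those of [dlog_tau j] up to sign. *)
Lemma dlog_tau_closed i j k l s :
  d j l (dlog_tau i k s) = d i k (dlog_tau j l s).
Proof.
pose L := psmap (d i k) (u j s) * v j s.
have uL : psmap (d i k) (u j s) = u j s * L by rewrite mulrCA uv mulr1.
have NL : flowder (d j) L = psmap (d i k) (dlog_u j s).
  apply: (mulrI_inv (uv j s)); apply: (addrI (flowder (d j) (u j s) * L)).
  rewrite -(flowder_leibniz (dM j)) -uL flowder_commute => [|? ?]; last exact: dC.
  rewrite flowder_u (psmap_leibniz (dM i k)) uL.
  by rewrite mulrAC.
have := congr1 (flowder (d j)) (dlog_tau_shift i j k s).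
rewrite flowder_phi raddfD /= NL flowderC => /(congr1 (@^~ l)).
rewrite psDE /psmap /dlog_tau => /esym /eqP; rewrite addr_eq0 => /eqP ->.
by rewrite raddfN.
Qed.

Lemma dlog_tau_step i j k s :
  dlog_tau i k (s + estep j) =
  dlog_tau i k s + d i k (u j s 0%N) * v j s 0%N.
Proof.
have [phi0 _] := phi_flow j.
have := congr1 (@^~ 0%N) (dlog_tau_shift i j k s).
by rewrite phi0 psDE psM0.
Qed.

(** The prescribed derivatives of log tau cancel [dlog_u], so u_i(p) tau is killed by
    [flowder (d i)] and is the flow of its constant term. *)
Lemma tau_shift (tau : site -> A) :
  (forall i k s, d i k (tau s) = dlog_tau i k s * tau s) ->
  (forall i s, tau (s + estep i) = u i s 0%N * tau s) ->
  forall i s, phi i (tau (s + estep i)) = u i s * psC (tau s).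
Proof.
move=> tau_d tau_s i s; have [phi0 phiD] := phi_flow i.
apply: (flow_uniq tfA (phiD _)); last by rewrite phi0 psM0.
apply/flowder_eq0; rewrite (flowder_leibniz (dM i)) flowder_u -mulrA -mulrDr.
rewrite (_ : _ + _ = 0) ?mulr0 //; apply: psP => n.
by rewrite psDE psMC flowderC tau_d /dlog_tau mulNr subrr.
Qed.

End TauEquations.

(** * Potentials on Z^N *)

Section Lattice.
Variable N : nat.
Local Notation site := 'rV[int]_N.
Implicit Types (s : site) (g h : 'I_N).
Local Notation unitv g := (delta_mx 0 g : site).

(** Lattice paths from 0 follow the axes one after another; this is the position after n of them. *)
Definition truncate n s : site := \row_g (if (g < n)%N then s 0 g else 0).

Let truncate0 s : truncate 0 s = 0.
Proof. by apply/rowP => g; rewrite !mxE. Qed.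

Let truncateN s : truncate N s = s.
Proof. by apply/rowP => g; rewrite !mxE ltn_ord. Qed.

Let truncateS n (nN : (n < N)%N) s :
  truncate n.+1 s = truncate n s + s 0 (Ordinal nN) *: unitv (Ordinal nN).
Proof.
apply/rowP => g; rewrite !mxE /= ltnS -[g == _]val_eqE /=.
have [gn|gn|gn] := ltngtP (val g) n; rewrite ?mulr0 ?addr0 //.
by rewrite mulr1 add0r; congr (s 0 _); apply: val_inj.
Qed.

Let truncateD n s g : truncate n (s + unitv g) =
  if (g < n)%N then truncate n s + unitv g else truncate n s.
Proof.
have gE h : (0 == 0 :> 'I_1) && (h == g) = (val h == val g) by [].
apply/rowP => h; case: ltnP => gn; rewrite !mxE gE; case: ltnP => // hn.
  by rewrite add0r; case: eqP => // /val_inj hg; move: gn hn; rewrite hg; lia.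
by case: eqP => [/val_inj hg|]; rewrite ?addr0 //; move: gn hn; rewrite hg; lia.
Qed.

Lemma lattice_ind (P : site -> Prop) :
  P 0 -> (forall s g, P s <-> P (s + unitv g)) -> forall s, P s.
Proof.
move=> P0 PS s; suff H n : (n <= N)%N -> P (truncate n s).
  by have := H N (leqnn N); rewrite truncateN.
elim: n => [|n IHn] nN; first by rewrite truncate0.
rewrite (truncateS nN); move: (s 0 _) => m; set e := unitv _.
have step m' : P (truncate n s + m' *: e) <-> P (truncate n s + (m' + 1) *: e).
  by rewrite scalerDl scale1r addrA; apply: PS.
have [k [->|->]] : exists k : nat, m = k%:Z \/ m = - k%:Z.
  by exists `|m|%N; lia.
  elim: k => [|k IHk]; first by rewrite scale0r addr0; apply: IHn; lia.
  have -> : k.+1%:Z = k%:Z + 1 by lia.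
  by apply: (step _).1.
elim: k => [|k IHk]; first by rewrite oppr0 scale0r addr0; apply: IHn; lia.
apply: (step _).2; rewrite (_ : - _ + 1 = - k%:Z) //; lia.
Qed.

Variable A : comUnitRingType.

(** Product of f along the path from 0 to m, with inverses for m < 0, so that [int_prodS] holds for
    every integer. *)
Definition int_prod (f : int -> A) (m : int) : A :=
  match m with
  | Posz n => \prod_(l < n) f l%:Z
  | Negz n => \prod_(l < n.+1) (f (Negz l))^-1
  end.

Lemma int_prodS (f : int -> A) m :
  (forall k, f k \is a GRing.unit) -> int_prod f (m + 1) = f m * int_prod f m.
Proof.
move=> fU; case: m => [n|[|n]].
- by rewrite /= addn1 big_ord_recr mulrC.
- by rewrite [RHS]/= big_ord1 divrr //; apply: big_ord0.
rewrite (_ : Negz n.+1 + 1 = Negz n); last by lia.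
by rewrite /= [in RHS]big_ord_recr /= mulrCA divrr ?mulr1.
Qed.

Lemma int_prod_unit (f : int -> A) m :
  (forall k, f k \is a GRing.unit) -> int_prod f m \is a GRing.unit.
Proof.
by move=> fU; case: m => n; apply: rpred_prod => l _; rewrite ?unitrV.
Qed.

Variable f : 'I_N -> site -> A.
Hypothesis fU : forall g s, f g s \is a GRing.unit.
Hypothesis f_closed : forall g h s,
  f g s * f h (s + unitv g) = f h s * f g (s + unitv h).

Let path h s m := int_prod (fun k => f h (s + k *: unitv h)) m.

Let pathS h s m : path h s (m + 1) = f h (s + m *: unitv h) * path h s m.
Proof. exact: int_prodS. Qed.

(** Closedness on unit squares, multiplied along a strip: moving a path by one step in direction g
    changes its product by the ratio of the values of [f g] at its two ends. *)
Let path_shift g h s m :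
  path h (s + unitv g) m * f g s = f g (s + m *: unitv h) * path h s m.
Proof.
pose Q m := path h (s + unitv g) m * f g s = f g (s + m *: unitv h) * path h s m.
have step m' : Q m' <-> Q (m' + 1).
  pose S := s + m' *: unitv h.
  rewrite /Q !pathS scalerDl scale1r addrA -/S -mulrA.
  have -> : s + unitv g + m' *: unitv h = S + unitv g by rewrite addrAC.
  have -> : f g (S + unitv h) * (f h S * path h s m') =
      f h (S + unitv g) * (f g S * path h s m').
    by rewrite !mulrA [f g _ * _]mulrC -f_closed [f g _ * _]mulrC.
  by split=> [->//|]; apply: mulrI; exact: fU.
have Q0 : Q 0 by rewrite /Q scale0r addr0 /path /= !big_ord0 mulr1 mul1r.
have [k [->|->]] : exists k : nat, m = k%:Z \/ m = - k%:Z.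
  by exists `|m|%N; lia.
  elim: k => // k IHk.
  have -> : k.+1%:Z = k%:Z + 1 by lia.
  by apply: (step _).1.
elim: k => // k IHk; apply: (step _).2.
rewrite (_ : - _ + 1 = - k%:Z) //; lia.
Qed.

(** Induction on the number of active coordinates: the potential is continued along the next axis by
    [path], and [path_shift] keeps it compatible with steps in the earlier directions. *)
Lemma lattice_potential : exists c : site -> A, [/\ c 0 = 1,
  forall s, c s \is a GRing.unit &
  forall g s, c (s + unitv g) = f g s * c s].
Proof.
pose potential n := exists c : site -> A,
  [/\ c 0 = 1, forall s, c s \is a GRing.unit &
    forall g s, (g < n)%N -> c (truncate n (s + unitv g)) =
      f g (truncate n s) * c (truncate n s)].
suff H n : (n <= N)%N -> potential n.
  have [c [c0 cU cS]] := H N (leqnn N); exists c; split=> // g s.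
  by have := cS g s (ltn_ord g); rewrite !truncateN.
elim: n => [|n IHn] nN.
  by exists (fun=> 1); split=> // s; rewrite unitr1.
have [|c [c0 cU cS]] := IHn; first exact: ltnW.
pose k := Ordinal nN.
exists (fun s => c (truncate n s) * path k (truncate n s) (s 0 k)).
have tt s : truncate n (truncate n.+1 s) = truncate n s.
  by apply/rowP => g; rewrite !mxE; case: ifP => // gn; rewrite ltnS ltnW.
have tk s : truncate n.+1 s 0 k = s 0 k by rewrite mxE ltnSn.
split.
- rewrite (_ : truncate n 0 = 0) ?c0 ?mxE ?mul1r /path /= ?big_ord0 //.
  by apply/rowP => g; rewrite !mxE if_same.
- by move=> s; rewrite unitrM cU int_prod_unit.
move=> g s gn; rewrite !tt !tk truncateD mxE.
case: ltnP => [gn'|ng].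
  rewrite mxE (_ : k == g = false) ?andbF ?addr0; last by rewrite -val_eqE /=; lia.
  have := cS g s gn'; rewrite truncateD gn' => ->.
  by rewrite (truncateS nN) [RHS]mulrCA -path_shift; ring.
have -> : g = k by apply/val_inj => /=; lia.
by rewrite mxE !eqxx /= pathS (truncateS nN) mulrCA.
Qed.

End Lattice.

(** * Power series in infinitely many variables *)

Section Multisets.
Local Open Scope mset_scope.
Variable V : choiceType.
Implicit Types (m a b : {mset V}) (v : V).

Definition splits m : {fset {mset V} * {mset V}} :=
  fset_set [set p : {mset V} * {mset V} | (p.1 `+` p.2)%mset = m]%classic.

Lemma in_splits p m : (p \in splits m) = (p.1 `+` p.2 == m).
Proof.
rewrite in_fset_set; first by apply/idP/eqP; rewrite inE.
have [S hS] := msubsets_finite m.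
apply: (sub_finite_set _ (finite_fset (S `*` S)%fset)) => -[a b] /= ab.
by rewrite inE /= !hS // -ab; apply/msubsetP => x; rewrite msetE2 ?leq_addr ?leq_addl.
Qed.

Lemma size_msetD a b : size (a `+` b) = (size a + size b)%N.
Proof.
rewrite -size_cat; apply: perm_size; apply/allP => v _ /=.
by rewrite count_cat !count_mem_mset msetE2.
Qed.

Lemma size_mset1 v : size [mset v] = 1%N.
Proof. by rewrite enum_msetn. Qed.

Lemma mset_case m : m = mset0 \/ exists v m', m = v +` m'.
Proof.
have [->|] := eqVneq m mset0; first by left.
move=> m0; right; have [v vm] : exists v, v \in m.
  apply: contra_notP (elimN eqP m0) => nv; apply/msetP => v; rewrite mset0E.
  by apply/mset_eq0P/negP => vm; apply: nv; exists v.
by exists v, (m `\ v); rewrite msetB1K.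
Qed.

End Multisets.

Section FpsDerivations.
Local Open Scope mset_scope.
Variables (V : choiceType) (K : comNzRingType).
Implicit Types (f g h : fps V K) (m : {mset V}) (u v : V).

Lemma fpsP f g : f =1 g -> f = g. Proof. exact: funext. Qed.
Lemma fpsDE f g m : (f + g) m = f m + g m. Proof. by []. Qed.
Lemma fpsNE f m : (- f) m = - f m. Proof. by []. Qed.

Lemma fps_mulrnE f k m : (f *+ k) m = f m *+ k.
Proof. by elim: k => // k IHk; rewrite !mulrS fpsDE IHk. Qed.

Lemma fps_sumE I (r : seq I) (P : pred I) (F : I -> fps V K) m :
  (\sum_(i <- r | P i) F i) m = \sum_(i <- r | P i) F i m.
Proof. by elim/big_rec2: _ => // i x f _ <-. Qed.

Lemma fpsME f g m : (f * g) m = \sum_(p <- splits m) f p.1 * g p.2.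
Proof.
rewrite -[LHS]/(conv (@msetD V) f g m) /conv (fsbigE (splits m)) //.
- rewrite big_seq_cond [RHS]big_seq; apply: eq_bigl => p.
  by rewrite in_splits andb_idr // => /eqP E; rewrite mem_set.
- by move=> p /=; rewrite in_splits => /eqP.
by move=> p /= pm; rewrite in_splits pm eqxx.
Qed.

Definition fps_deriv v f : fps V K := fun m => f (v +` m) *+ (m v).+1.

Let fps_deriv_additive v : additive (fps_deriv v).
Proof. by move=> f g; apply: fpsP => m; rewrite /fps_deriv fpsDE fpsNE mulrnBl. Qed.
HB.instance Definition _ v :=
  GRing.isAdditive.Build (fps V K) (fps V K) (fps_deriv v) (fps_deriv_additive v).

Lemma fps_deriv_leibniz v : leibniz (fps_deriv v).
Proof.
have half f g m : \sum_(p <- splits (v +` m)) (f p.1 *+ p.1 v) * g p.2 =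
    (fps_deriv v f * g) m.
  rewrite fpsME; pose h p : {mset V} * {mset V} := (v +` p.1, p.2).
  have h_inj : injective h.
    by move=> [a b] [c d] [/(congr1 (msetB^~ [mset v]))]; rewrite !msetD1K => -> ->.
  rewrite (bigID (fun p : {mset V} * {mset V} => v \in p.1)) /= [X in _ + X]big1 ?addr0; last first.
    by move=> p /mset_eq0P ->; rewrite mulr0n mul0r.
  rewrite -big_filter (perm_big (map h (splits m))) ?big_map /=.
    by apply: eq_bigr => p _; rewrite mset1DE eqxx add1n.
  apply: uniq_perm; rewrite ?filter_uniq ?map_inj_uniq ?fset_uniq //.
  move=> [a b]; rewrite mem_filter /= in_splits /=; apply/andP/mapP.
    move=> [va /eqP E]; exists (a `\ v, b); last by rewrite /h /= msetB1K.
    by rewrite in_splits /=; apply/eqP/(can_inj (msetDKB [mset v])); rewrite msetDA msetB1K.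
  by move=> [[c e]]; rewrite in_splits /= => /eqP <- [-> ->]; rewrite mset1D1 msetDA.
move=> f g; apply: fpsP => m; rewrite fpsDE -half [f * fps_deriv v g]mulrC -half.
rewrite /fps_deriv fpsME -sumrMnl.
have -> : \sum_(p <- splits (v +` m)) (g p.1 *+ p.1 v) * f p.2 =
    \sum_(p <- splits (v +` m)) f p.1 * (g p.2 *+ p.2 v).
  pose sw (p : {mset V} * {mset V}) := (p.2, p.1).
  have sw_inj : injective sw by move=> [a b] [c d] [-> ->].
  rewrite (perm_big (map sw (splits (v +` m)))) ?big_map /=.
    by apply: eq_bigr => p _; rewrite mulrC.
  apply: uniq_perm; rewrite ?map_inj_uniq ?fset_uniq // => -[a b].
  rewrite in_splits /=; apply/eqP/mapP.
    by move=> E; exists (b, a) => //; rewrite in_splits /= msetDC E.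
  by move=> [[c e]]; rewrite in_splits /= => /eqP <- [-> ->]; rewrite msetDC.
rewrite -big_split /=; apply: eq_big_seq => p; rewrite in_splits => /eqP E.
have -> : (m v).+1 = (p.1 v + p.2 v)%N by rewrite -msetE2 E mset1DE eqxx.
by rewrite mulrnAl mulrnAr -mulrnDr.
Qed.

Lemma fps_derivC u v f : fps_deriv u (fps_deriv v f) = fps_deriv v (fps_deriv u f).
Proof.
apply: fpsP => m; rewrite /fps_deriv -!mulrnA !mset1DE msetDCA.
have -> : (((v == u) + m v).+1 * (m u).+1 = ((u == v) + m u).+1 * (m v).+1)%N.
  by rewrite [u == v]eq_sym; case: (eqVneq v u) => [->|_] //; rewrite mulnC.
by [].
Qed.

Lemma fps_const0E (c : K) : (fps_const c : fps V K) mset0 = c.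
Proof. by rewrite /fps_const eqxx. Qed.

Lemma fps_oneE : 1 = fps_const 1 :> fps V K.
Proof. by apply: fpsP => m; rewrite /fps_const -[LHS]/(_ m == _)%:R; case: eqP. Qed.

Lemma fpsM_const (c : K) f m : (fps_const c * f) m = c * f m.
Proof.
have mm : (mset0, m) \in splits m by rewrite in_splits mset0D.
rewrite fpsME (big_fsetD1 _ mm) big1_seq; first by rewrite Monoid.mulm1 fps_const0E.
move=> [a b]; rewrite in_fsetD1 in_splits => /andP[_ /andP[ne /eqP ab]].
have [a0|a0] := eqVneq a mset0; last by rewrite /fps_const /= (negPf a0) mul0r.
by move: ne; rewrite -ab a0 /= mset0D eqxx.
Qed.

Lemma fpsM0 f g : (f * g) mset0 = f mset0 * g mset0.
Proof.
suff H m : m = mset0 -> (f * g) m = f mset0 * g mset0 by exact: H.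
move=> m0.
have mm : (mset0, mset0) \in splits m by rewrite in_splits mset0D m0.
rewrite fpsME (big_fsetD1 _ mm) big1_seq; first by rewrite Monoid.mulm1.
move=> [a b]; rewrite in_fsetD1 in_splits => /andP[_ /andP[/eqP ne /eqP ab]].
case: ne; congr pair; apply/eqP; rewrite -msubset0 -m0 -ab; apply/msubsetP => x.
  by rewrite msetE2 leq_addr.
by rewrite msetE2 leq_addl.
Qed.

Lemma fps_deriv_eq0 f : torsion_free K ->
  (forall v, fps_deriv v f = 0) -> f = fps_const (f mset0).
Proof.
move=> tf f0; apply: fpsP => m; rewrite /fps_const.
have [->|[v [m' ->]]] := mset_case m; first by rewrite eqxx.
rewrite ifN; first by apply: (tf _ (m' v)); exact: (congr1 (@^~ m') (f0 v)).
by apply/eqP => /msetP /(_ v); rewrite mset1DE eqxx mset0E.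
Qed.

Lemma fps_deriv_const v (c : K) : fps_deriv v (fps_const c) = 0.
Proof.
apply: fpsP => m; rewrite /fps_deriv /fps_const ifN ?mul0rn //.
by apply/eqP => /msetP /(_ v); rewrite mset1DE eqxx mset0E.
Qed.

End FpsDerivations.

Definition divisible (K : comNzRingType) := forall n, exists x : K, x *+ n.+1 = 1.

Lemma divisible_torsion_free (K : comNzRingType) : divisible K -> torsion_free K.
Proof.
move=> dK y n yn; have [x xn] := dK n.
by rewrite -[y]mulr1 -xn mulrnAr -mulrnAl yn mul0r.
Qed.

(** * Exponentials and the Poincare lemma *)

Section FpsExp.
Local Open Scope mset_scope.
Variables (V : choiceType) (K : comNzRingType).
Hypothesis divK : divisible K.
Implicit Types (f g h : fps V K) (m : {mset V}) (u v : V).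

Lemma fps_divisible : divisible (fps V K).
Proof.
move=> n; have [x xn] := divK n; exists (fps_const x).
apply: fpsP => m; rewrite fps_mulrnE fps_oneE /fps_const.
by case: eqP; rewrite ?mul0rn.
Qed.

Lemma fps_nat_unit n : (n.+1%:R : fps V K) \is a GRing.unit.
Proof.
by apply/unitrP; have [x xn] := fps_divisible n; exists x; rewrite mulr_natr mulr_natl.
Qed.

Lemma fps_fact_unit n : ((n`!)%:R : fps V K) \is a GRing.unit.
Proof. by case: n`! (fact_gt0 n) => // k _; apply: fps_nat_unit. Qed.

Lemma fps_deriv_nat v n : fps_deriv v (n%:R : fps V K) = 0.
Proof. by rewrite raddfMn (fps_oneE V K) /= fps_deriv_const mul0rn. Qed.

Lemma fps_deriv_divn v f c : c \is a GRing.unit -> fps_deriv v c = 0 ->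
  fps_deriv v (f / c) = fps_deriv v f / c.
Proof.
move=> cU c0; apply: (mulIr cU); rewrite divrK //.
have := fps_deriv_leibniz v (f / c) c; rewrite c0 mulr0 addr0 => <-.
by rewrite divrK.
Qed.

Lemma fps_deriv_exp v f n : fps_deriv v (f ^+ n.+1) = fps_deriv v f * f ^+ n *+ n.+1.
Proof.
elim: n => [|n IHn]; first by rewrite expr1 expr0 mulr1.
rewrite exprS fps_deriv_leibniz IHn [RHS]mulrS; congr (_ + _).
by rewrite mulrnAr mulrCA -exprS.
Qed.

(** In [fps_exp] the number of terms varies with the coefficient; a common truncation is a single
    polynomial in f, to which derivations apply. *)
Definition exp_trunc n f : fps V K := \sum_(k < n) f ^+ k / (k`!)%:R.

Lemma fps_deriv_exp_trunc v n f :
  fps_deriv v (exp_trunc n.+1 f) = fps_deriv v f * exp_trunc n f.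
Proof.
rewrite /exp_trunc raddf_sum big_ord_recl /= expr0.
rewrite fps_deriv_divn ?fps_fact_unit ?fps_deriv_nat //.
rewrite (fps_deriv_nat v 1) mul0r add0r mulr_sumr; apply: eq_bigr => k _.
rewrite fps_deriv_divn ?fps_fact_unit ?fps_deriv_nat // fps_deriv_exp mulrA.
apply: (mulIr (fps_fact_unit (bump 0 k))); rewrite divrK ?fps_fact_unit //.
rewrite /bump /= add1n factS natrM mulrA mulrAC.
by rewrite (divrK (fps_fact_unit k)) mulr_natr.
Qed.

Lemma fps_exp_small f n m : f mset0 = 0 -> (size m < n)%N -> (f ^+ n) m = 0.
Proof.
move=> f0; elim: n m => // n IHn m mn; rewrite exprS fpsME big1_seq // => -[a b].
rewrite in_splits /= => /eqP ab.
have [->|[v [c cE]]] := mset_case a; first by rewrite f0 mul0r.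
rewrite IHn ?mulr0 //; move: mn; rewrite -ab cE !size_msetD size_mset1.
by rewrite -addnA add1n ltnS; apply: leq_trans; rewrite ltnS leq_addl.
Qed.

Lemma fps_exp_truncE f n m : f mset0 = 0 -> (size m < n)%N ->
  fps_exp f m = exp_trunc n f m.
Proof.
move=> f0 mn; rewrite /fps_exp /exp_trunc !fps_sumE.
rewrite (big_ord_widen n (fun k => (f ^+ k / (k`!)%:R) m) mn) big_mkcond /=.
apply: eq_bigr => k _; case: ifPn => //; rewrite -leqNgt => mk.
have [c cE] : exists c : K, (k`!)%:R^-1 = fps_const c :> fps V K.
  case: k`! (fact_gt0 k) => // j _; have [x xj] := divK j; exists x.
  apply: (mulIr (fps_nat_unit j)); rewrite mulVr ?fps_nat_unit // mulr_natr.
  apply: fpsP => m'; rewrite fps_mulrnE fps_oneE /fps_const.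
  by case: eqP; rewrite ?mul0rn.
by rewrite cE mulrC fpsM_const fps_exp_small ?mulr0.
Qed.

Lemma fps_deriv_fps_exp v f : f mset0 = 0 ->
  fps_deriv v (fps_exp f) = fps_deriv v f * fps_exp f.
Proof.
move=> f0; apply: fpsP => m.
(* The derivative reads a coefficient of degree [size m + 1] and then shortens the truncation by
   one, hence [(size m).+2] terms. *)
transitivity (fps_deriv v (exp_trunc (size m).+2 f) m).
  rewrite /fps_deriv (@fps_exp_truncE f (size m).+2) //.
  by rewrite size_msetD size_mset1.
rewrite fps_deriv_exp_trunc !fpsME; apply: eq_big_seq => -[a b].
rewrite in_splits /= => /eqP ab; congr (_ * _); apply/esym/fps_exp_truncE => //.
by rewrite ltnS -ab size_msetD leq_addl.
Qed.

Lemma fps_exp0 f : fps_exp f mset0 = 1.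
Proof.
rewrite /fps_exp enum_mset0 big_ord1 expr0 fact0 divr1.
by rewrite fps_oneE fps_const0E.
Qed.

Lemma fps_expN f : f mset0 = 0 -> fps_exp f * fps_exp (- f) = 1.
Proof.
move=> f0; have Nf0 : (- f) mset0 = 0 by rewrite fpsNE f0 oppr0.
rewrite [LHS](fps_deriv_eq0 (divisible_torsion_free divK)).
  by rewrite fpsM0 !fps_exp0 mulr1 -fps_oneE.
move=> v; rewrite fps_deriv_leibniz !fps_deriv_fps_exp // raddfN /=.
by rewrite mulNr mulrN mulrCA mulrA subrr.
Qed.

(** The coefficient at m is obtained by integrating in the variable that the enumeration of m lists
    first; closedness gives the same value for any other variable of m. *)
Lemma fps_poincare (g : V -> fps V K) :
  (forall u v, fps_deriv u (g v) = fps_deriv v (g u)) ->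
  exists F, F mset0 = 0 /\ forall v, fps_deriv v F = g v.
Proof.
move=> g_closed.
have /choice [inv invE] : forall n, exists x : K, x *+ n.+1 = 1 by exact: divK.
pose F : fps V K := fun m =>
  if (m : seq V) is v :: _ then inv (m v).-1 * g v (m `\ v) else 0.
exists F; split; first by rewrite /F enum_mset0.
move=> v; apply: fpsP => m; rewrite /fps_deriv /F.
case E : (v +` m : seq V) => [|u s].
  by have := mset1D1 v m; rewrite in_mset -count_mem_mset E.
have um : u \in v +` m by rewrite in_mset -count_mem_mset E /= eqxx.
have [uv|uv] := eqVneq u v.
  subst u; rewrite mset1DE eqxx add1n /= -mulrnAl invE mul1r; congr (g v _).
  by rewrite msetD1K.
have {}um : u \in m by move: um; rewrite in_mset1D (negPf uv).
have mE := msetB1K um; set m' := m `\ u in mE.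
have := congr1 (@^~ m') (g_closed v u); rewrite /fps_deriv mE => gE.
have -> : (v +` m) `\ u = v +` m' by rewrite -mE msetDCA msetD1K.
have -> : (v +` m) u = (m' u).+1 by rewrite mset1DE (negPf uv) -mE mset1DE eqxx.
have -> : m v = m' v by rewrite -mE mset1DE eq_sym (negPf uv).
by rewrite -mulrnAr gE mulrnAr -mulrnAl invE mul1r.
Qed.

End FpsExp.

(** * The shifts of the times *)

Section LaurentMonomials.
Local Open Scope mset_scope.
Variables (K : comNzRingType) (d : zpoint).

Lemma laurentDE (f g : laurent K d) n : (f + g) n = f n + g n.
Proof. by []. Qed.

Lemma laurentNE (f : laurent K d) n : (- f) n = - f n.
Proof. by []. Qed.

Lemma laurent0E n : (0 : laurent K d) n = 0.
Proof. by rewrite /= if_same. Qed.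

Lemma laurent_sumE I (r : seq I) (P : pred I) (F : I -> laurent K d) n :
  (\sum_(i <- r | P i) F i) n = \sum_(i <- r | P i) F i n.
Proof. by elim/big_rec2: _ => [|i x f _ <-]; rewrite ?laurent0E. Qed.

Lemma laurent_mulrnE (f : laurent K d) k n : (f *+ k) n = f n *+ k.
Proof. by elim: k => [|k IHk]; rewrite ?laurent0E // !mulrS laurentDE IHk. Qed.

Lemma monomialME (a : K) k (f : laurent K d) n : (monomial d a k * f) n = a * f (n - k).
Proof.
rewrite -[LHS]/(conv +%R (monomial d a k) f n).
rewrite (@conv_fset _ _ _ [fset k; n - k]%fset); last first.
  move=> i j <- /monomial_neq0 -> _.
  by rewrite !inE eqxx [k + j]addrC addrK eqxx orbT.
rewrite (big_fsetD1 k) ?inE ?eqxx //= [X in _ + X]big1_seq ?addr0.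
  rewrite (big_fsetD1 (n - k)) ?inE ?eqxx ?orbT //= big1_seq ?addr0.
    by rewrite [k + _]addrC subrK eqxx.
  move=> j; rewrite !inE => /andP[_ /andP[jn _]].
  by case: eqP => // E; move: jn; rewrite -E addrC addKr eqxx.
move=> i; rewrite !inE => /andP[_ /andP[/negPf ik _]].
by rewrite big1 // => j _; rewrite ik mul0r if_same.
Qed.

Lemma monomialM (a b : K) k l :
  monomial d a k * monomial d b l = monomial d (a * b) (k + l).
Proof.
apply/laurentP => n; rewrite monomialME /= subr_eq [l + k]addrC.
by case: eqP; rewrite ?mulr0.
Qed.

End LaurentMonomials.

Section MiwaShift.
Local Open Scope mset_scope.
Variables (R : realType) (N : nat).
Local Notation C := R[i].
Local Notation V := (tvar N).
Variables (eps : C) (bar : bool) (a : 'I_N).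
Implicit Types (m k : {mset V}) (f : tseries R N).

Let var j : V := (bar, a, j).

Definition pure k := all (fun v : V => v.1 == (bar, a)) k.
Definition weight k := (\sum_(v <- k) v.2.+1)%N.
Definition miwa_coef k : C := \prod_(v <- k) (eps / v.2.+1%:R).
Definition mbinom m k := (\prod_(v <- undup k) 'C((m `+` k) v, m v))%N.

Let perm_mset1D (v : V) k : perm_eq (v +` k) (v :: k).
Proof.
apply/allP => u _ /=.
by rewrite !count_mem_mset mset1DE [v == u]eq_sym.
Qed.

Let pure1D v k : pure (v +` k) = (v.1 == (bar, a)) && pure k.
Proof. by rewrite /pure (perm_all _ (perm_mset1D v k)). Qed.

Let weight1D v k : weight (v +` k) = (v.2.+1 + weight k)%N.
Proof. by rewrite /weight (perm_big _ (perm_mset1D v k)) big_cons. Qed.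

Let miwa_coef1D v k : miwa_coef (v +` k) = eps / v.2.+1%:R * miwa_coef k.
Proof. by rewrite /miwa_coef (perm_big _ (perm_mset1D v k)) big_cons. Qed.

Lemma miwa_prod k : \prod_(v <- k) miwa eps bar a v =
  if pure k then monomial Infinity (miwa_coef k) (- (weight k)%:Z) else 0.
Proof.
rewrite /pure /miwa_coef /weight; elim: (k : seq V) => [|[[b' a'] j] s IHs].
  by rewrite !big_nil.
rewrite !big_cons IHs /= -[X in _ = if X && _ then _ else _]xpair_eqE.
rewrite -[(b', a') == (bar, a)]/((b' == bar) && (a' == a)).
case: ifP => /= _; last by rewrite mul0r.
by case: ifP => _; rewrite ?mulr0 // monomialM PoszD opprD.
Qed.

Lemma pure_finite n : exists S : {fset {mset V}},
  forall k, pure k -> (weight k <= n)%N -> k \in S.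
Proof.
elim: n => [|n [S hS]].
  exists [fset mset0]%fset => k _; have [->|[v [k' ->]]] := mset_case k.
    by rewrite in_fset1.
  by rewrite weight1D.
exists (mset0 |` [fset var j +` k | j in iota 0 n.+1, k in S])%fset => k.
have [->|[[[b' a'] j] [k' ->]]] := mset_case k; first by rewrite in_fset1U eqxx.
rewrite pure1D weight1D /= => /andP[/eqP [-> ->] pk] wk.
rewrite in_fset1U; apply/orP; right; apply/imfset2P; exists j => /=.
  by rewrite inE mem_iota; lia.
by exists k' => //; apply: hS => //; lia.
Qed.

(** Such multisets are the partitions of n, the variable (bar, a, j) standing for a part j + 1. *)
Definition ppart n : {fset {mset V}} :=
  fset_set [set k | pure k /\ weight k = n]%classic.

Lemma in_ppart n k : (k \in ppart n) = pure k && (weight k == n).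
Proof.
rewrite in_fset_set.
  by apply/idP/andP; rewrite inE => -[? /eqP].
have [S hS] := pure_finite n.
apply: (sub_finite_set _ (finite_fset S)) => k' [pk wk] /=.
by apply: hS => //; rewrite wk.
Qed.

Lemma shift_coefE f m n : shift_coef eps bar a f m (- n%:Z) =
  \sum_(k <- ppart n) f (m `+` k) *+ mbinom m k * miwa_coef k.
Proof.
have termE k : shift_term eps bar a f m k (- n%:Z) =
    if k \in ppart n then f (m `+` k) *+ mbinom m k * miwa_coef k else 0.
  rewrite /shift_term miwa_prod in_ppart -/(mbinom m k).
  case: (pure k); last by rewrite mulr0 laurent0E.
  rewrite monomialME subr0 /= eqr_opp eqz_nat [n == _]eq_sym.
  by case: ifP; rewrite ?mulr0.
rewrite /shift_coef (fsbigE (ppart n)) //.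
  rewrite big_mkcond [RHS]big_seq [LHS]big_seq; apply: eq_bigr => k kn.
  by rewrite in_setT termE kn.
by move=> k _ /negPf kn; rewrite termE kn.
Qed.

Lemma mbinom_widen m k (U : {fset V}) : (finsupp k `<=` U)%fset ->
  mbinom m k = (\prod_(v <- U) 'C((m `+` k) v, m v))%N.
Proof.
move=> kU; rewrite /mbinom (perm_big _ (perm_undup_mset k)) /=.
apply: big_fset_incl => // v _; rewrite msuppE => vk.
by rewrite msetE2 (mset_eq0P vk) addn0 binn.
Qed.

(** At v, with total multiplicity n, this is C(n, m v + 1) (m v + 1) = C(n, m v) (n - m v); the
    other factors agree. *)
Lemma mbinom_step v m k :
  (mbinom (v +` m) k * (m v).+1 = mbinom m (v +` k) * (k v).+1)%N.
Proof.
pose U := finsupp (v +` k).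
have vU : v \in U by rewrite msuppE mset1D1.
rewrite (@mbinom_widen m (v +` k) U) ?fsubset_refl //.
rewrite (@mbinom_widen (v +` m) k U); last first.
  by apply/fsubsetP => u; rewrite !msuppE; exact: mset1Dr.
rewrite !(big_fsetD1 v vU) /=.
have -> : v +` m `+` k = m `+` (v +` k) by rewrite msetDCA msetDA.
rewrite mulnAC [in RHS]mulnAC mset1DE eqxx add1n; congr (_ * _)%N.
  rewrite mulnC mul_bin_left mulnC; congr (_ * _)%N.
  by rewrite msetE2 mset1DE eqxx add1n addKn.
rewrite !big_seq; apply: eq_bigr => u; rewrite in_fsetD1 => /andP[/negPf uv _].
by rewrite mset1DE uv.
Qed.

Lemma weight_sum n k : pure k -> weight k = n.+1 ->
  n.+1 = (\sum_(j < n.+1) k (var j) * j.+1)%N.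
Proof.
move=> pk wk; rewrite -{1}wk.
have wU (k' : {mset V}) l : pure k' -> (weight k' <= l)%N ->
    weight k' = (\sum_(j < l) k' (var j) * j.+1)%N.
  move: {2}(size k') (leqnn (size k')) => s.
  elim: s k' => [|s IHs] k'.
    have [-> _ _ _|[v [k1 ->]]] := mset_case k'; last by rewrite size_msetD size_mset1.
    by rewrite /weight enum_mset0 big_nil big1 // => j _; rewrite mset0E.
  have [-> _ _ _|[[[b' a'] i] [k1 ->]]] := mset_case k'.
    by rewrite /weight enum_mset0 big_nil big1 // => j _; rewrite mset0E.
  rewrite size_msetD size_mset1 ltnS pure1D weight1D /= => sk /andP[/eqP [-> ->] pk1] wl.
  rewrite (IHs k1) //; last by lia.
  under [RHS]eq_bigr do rewrite mset1DE mulnDl.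
  rewrite big_split /=; congr (_ + _)%N.
  have il : (i < l)%N by lia.
  rewrite (bigD1 (Ordinal il)) //= eqxx mul1n big1 ?addn0 // => j ji.
  case: eqP => [[E]|_]; last by rewrite mul0n.
  by case/eqP: ji; apply: val_inj.
by rewrite {1}(wU k n.+1) ?wk.
Qed.

(** The flow equation for the binomially defined shift: each partition of n + 1 is counted n + 1
    times, as the sum of its parts, and removing a part j + 1 leaves a partition of n - j. *)
Lemma shift_coef_rec f m n :
  shift_coef eps bar a f m (- n.+1%:Z) *+ n.+1 =
  \sum_(j < n.+1) eps * fps_deriv (var j)
     (fun m' => shift_coef eps bar a f m' (- (n - j)%:Z)) m.
Proof.
pose X k := f (m `+` k) *+ mbinom m k.
transitivity (\sum_(j < n.+1) \sum_(k <- ppart n.+1)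
    X k * miwa_coef k *+ (k (var j) * j.+1)).
  rewrite exchange_big shift_coefE -sumrMnl /=; apply: eq_big_seq => k.
  rewrite in_ppart => /andP[pk /eqP wk].
  by rewrite sumrMnr -(weight_sum pk wk).
apply: eq_bigr => j _; rewrite /fps_deriv shift_coefE -sumrMnl mulr_sumr.
rewrite (bigID (fun k : {mset V} => var j \in k)) /= [X in _ + X]big1 ?addr0; last first.
  by move=> k /mset_eq0P ->; rewrite mul0n mulr0n.
rewrite -big_filter (perm_big (map (msetD [mset (var j)]) (ppart (n - j)))).
  rewrite big_map /=; apply: eq_bigr => k _.
  rewrite miwa_coef1D mset1DE eqxx add1n /X.
  have -> : m `+` (var j +` k) = var j +` m `+` k by rewrite msetDCA msetDA.
  have E : (mbinom (var j +` m) k)%:R * (m (var j)).+1%:R =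
      (mbinom m (var j +` k))%:R * (k (var j)).+1%:R :> C.
    by rewrite -!natrM mbinom_step.
  have J : j.+1%:R != 0 :> C by rewrite pnatr_eq0.
  rewrite -(mulr_natr (f _)) -(mulr_natr (f _) (mbinom _ k)) -!(mulr_natr (_ * _)).
  rewrite natrM; set F := f _; set B1 := _%:R in E *; set c := miwa_coef k.
  transitivity (F * ((mbinom m (var j +` k))%:R * (k (var j)).+1%:R) *
    eps * c * (j.+1%:R^-1 * j.+1%:R)); first by rewrite /=; ring.
  by rewrite mulVf // -E; ring.
apply: uniq_perm; rewrite ?filter_uniq ?map_inj_uniq ?fset_uniq //.
  by move=> k k' /(congr1 (msetB^~ [mset (var j)])); rewrite !msetD1K.
move=> k; rewrite mem_filter; apply/andP/mapP.
  move=> [jk]; rewrite in_ppart -{1 2}(msetB1K jk) pure1D weight1D /=.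
  move=> /andP[/andP[_ pk] /eqP wk]; exists (k `\ var j); last by rewrite msetB1K.
  by rewrite in_ppart pk; apply/eqP; move: (weight _) wk => w; lia.
move=> [k']; rewrite in_ppart => /andP[pk /eqP wk] ->; rewrite mset1D1; split=> //.
rewrite in_ppart pure1D weight1D /= eqxx pk /= wk; apply/eqP.
by have := ltn_ord j; lia.
Qed.

End MiwaShift.

(** * Existence of flows *)

Section FlowExistence.
Variables (A : comUnitRingType) (D : nat -> {additive A -> A}).
Hypothesis nat_unit : forall n, (n.+1%:R : A) \is a GRing.unit.

(** Coefficients found so far, latest first, since each one depends on all earlier ones. *)
Fixpoint flow_list f n : seq A :=
  if n is n'.+1
  then (n%:R^-1 * \sum_(k < n) D k (flow_list f n')`_k) :: flow_list f n'
  else [:: f].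

Definition flow f : ps A := fun n => (flow_list f n)`_0.

Lemma flow_is_flow : is_flow D flow.
Proof.
have nthE f n k : (k <= n)%N -> (flow_list f n)`_k = flow f (n - k)%N.
  elim: n k => [|n IHn] [|k] //= kn; exact: IHn.
split=> // f; apply: psP => n; rewrite dserE /psderiv {1}/flow /=.
rewrite -mulrnAl -[X in X * _]mulr_natr mulVr // mul1r.
by apply: eq_bigr => k _; rewrite nthE // -ltnS.
Qed.

End FlowExistence.

Section TorsionFreeFlow.
Variables (A : comUnitRingType) (D : nat -> {additive A -> A}).
Hypothesis tfA : torsion_free A.

Lemma flow_const f phi : is_flow D phi -> (forall k, D k f = 0) -> phi f = psC f.
Proof.
move=> [phi0 phiD] Df; apply: (flow_uniq tfA (phiD f)); last by rewrite phi0.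
apply: psP => n; rewrite dserE big1; first exact: mul0rn.
by move=> k _; case: (n - k)%N => [|j]; [exact: Df | exact: raddf0].
Qed.

End TorsionFreeFlow.

Section ZSeries.
Local Open Scope mset_scope.
Variables (R : realType) (N : nat).
Local Notation C := R[i].
Local Notation V := (tvar N).
Local Notation Z d := (zseries R N d).
Local Notation T := (tseries R N).
Local Notation zp d := (@zpow R N d).

Lemma C_divisible : divisible C.
Proof.
move=> n; exists (n.+1%:R^-1); rewrite -[LHS]mulr_natr mulVf //.
by rewrite pnatr_eq0.
Qed.

Lemma laurent_divisible d : divisible (laurent C d).
Proof.
move=> n; have [x xn] := C_divisible n; exists (monomial d x 0).
apply/laurentP => k; rewrite laurent_mulrnE /=.
by case: eqP => _; rewrite ?mul0rn.
Qed.

Section AtPoint.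
Variable d : zpoint.

Lemma zpowD k l : zp d (k + l) = zp d k * zp d l.
Proof.
apply: fpsP => m; rewrite fpsM_const /zpow /fps_const.
by case: eqP => _; rewrite ?mulr0 // monomialM mulr1.
Qed.

Lemma zpow0 : zp d 0 = 1.
Proof. by rewrite (@fps_oneE V (laurent C d)). Qed.

Lemma zpowME k (f : Z d) m n : (zp d k * f) m n = f m (n - k).
Proof. by rewrite fpsM_const monomialME mul1r. Qed.

Lemma fps_deriv_linear (K : comNzRingType) (c : V -> K) v :
  fps_deriv v (fps_linear c) = fps_const (c v).
Proof.
apply: fpsP => m; rewrite /fps_deriv /fps_const /fps_linear.
have [->|[u [m' ->]]] := mset_case m.
  by rewrite eqxx mset0E msetD0 enum_msetn.
rewrite ifN; last by apply/eqP => /msetP /(_ u); rewrite mset1DE eqxx mset0E.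
have : (1 < size (v +` (u +` m')))%N by rewrite !size_msetD !size_mset1.
by case: (v +` (u +` m') : seq V) => [|x [|y l]] //; rewrite mul0rn.
Qed.

Lemma fps_linear0 (K : comNzRingType) (c : V -> K) : fps_linear c mset0 = 0.
Proof. by rewrite /fps_linear enum_mset0. Qed.

Lemma xi0 bar a e : @xi R N d bar a e mset0 = 0.
Proof. exact: fps_linear0. Qed.

Lemma fps_deriv_xi bar a e bar' a' k :
  fps_deriv (bar', a', k) (@xi R N d bar a e) =
  if (bar', a') == (bar, a) then zp d (e * k.+1%:Z) else 0.
Proof.
rewrite /xi fps_deriv_linear xpair_eqE; case: ifP => // _.
by apply: fpsP => m; rewrite /fps_const if_same.
Qed.

End AtPoint.

(** The ring morphism that carries identities between series in z^-1 over to wave functions. *)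
Definition texp (w : ps T) : Z Infinity := expansion Infinity w.

Lemma texpE (w : ps T) m n : texp w m n =
  if n is Posz k.+1 then 0 else w `|n|%N m.
Proof. by rewrite /=; case: n => [[|k]|k]. Qed.

Let texp_additive : additive texp.
Proof.
move=> w w'; apply: fpsP => m; apply/laurentP => n.
rewrite fpsDE fpsNE laurentDE laurentNE !texpE.
by case: n => [[|k]|k]; rewrite ?subr0.
Qed.
HB.instance Definition _ := GRing.isAdditive.Build (ps T) (Z Infinity)
  texp texp_additive.

Let texpM1 (w w' : ps T) a b n :
  (texp w a * texp w' b) n =
  if n is Posz k.+1 then 0
  else \sum_(i < `|n|.+1) w i a * w' (`|n| - i)%N b.
Proof.
pose f := texp w a; pose g := texp w' b.
rewrite -[LHS]/(conv +%R f g n).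
have fE k : f (- k%:Z) = w k a by rewrite /f texpE; case: k.
have gE k : g (- k%:Z) = w' k b by rewrite /g texpE; case: k.
have f0 (k : nat) : f k.+1%:Z = 0 by rewrite /f texpE.
have g0 (k : nat) : g k.+1%:Z = 0 by rewrite /g texpE.
clearbody f g.
have neg (f' : laurent C Infinity) i : (forall k : nat, f' k.+1%:Z = 0) ->
    f' i != 0 -> exists k : nat, i = - k%:Z.
  move=> f'0; case: i => [[|i]|i]; [by exists 0%N| by rewrite f'0 eqxx|].
  by exists i.+1; rewrite NegzE.
have [n0|n0] := ltP 0 n.
  transitivity (0 : C); last by case: n n0 => [[|k]|k].
  apply: fsbig1 => -[i j] /= ij; apply: contraTeq n0; rewrite mulf_eq0 negb_or.
  move=> /andP[/(neg _ _ f0) [i' iE] /(neg _ _ g0) [j' jE]].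
  by rewrite -ij iE jE -leNgt; lia.
have [k ->] : exists k : nat, n = - k%:Z by exists `|n|%N; lia.
rewrite abszN /= (_ : (if _ is Posz _.+1 then _ else _) =
  \sum_(i < k.+1) w i a * w' (k - i)%N b); last by case: (k).
rewrite /conv (fsbigE [seq (- i%:Z, - (k - i)%:Z) | i <- index_iota 0%N k.+1]).
- rewrite big_map big_mkcond big_mkord; apply: eq_bigr => i _; rewrite mem_set /= ?fE ?gE //.
  by have := ltn_ord i; lia.
- by rewrite map_inj_uniq ?iota_uniq // => i j [] /=; lia.
- move=> p /mapP [l]; rewrite mem_index_iota => ? -> /=; lia.
move=> [i j] ij; apply: contraNeq; rewrite mulf_eq0 negb_or.
move=> /andP[/(neg _ _ f0) [i' iE] /(neg _ _ g0) [j' jE]].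
rewrite /= in iE jE; have {}ij : - i'%:Z + - j'%:Z = - k%:Z by rewrite -iE -jE.
apply/mapP; exists i'; first by rewrite mem_index_iota; lia.
by rewrite iE jE; congr pair; lia.
Qed.

Let texp_mul : monoid_morphism texp.
Proof.
split=> [|w w'].
  rewrite (@fps_oneE V (laurent C Infinity)); apply: fpsP => m.
  apply/laurentP => n; rewrite texpE /fps_const.
  have one0 : (1 : ps T) 0%N m = if m == mset0 then 1 else 0.
    by rewrite -[LHS]/((1 : T) m) (@fps_oneE V C).
  case: n => [[|k]|k]; last 2 first.
  - by case: eqP.
  - by case: eqP.
  by rewrite /= one0; case: eqP.
apply: fpsP => m; apply/laurentP => n; rewrite fpsME laurent_sumE.
under [RHS]eq_bigr do rewrite texpM1.
rewrite texpE psME fps_sumE.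
under [in LHS]eq_bigr do rewrite fpsME.
rewrite exchange_big; case: n => [[|k]|k] //.
by rewrite big1.
Qed.
HB.instance Definition _ := GRing.isMonoidMorphism.Build (ps T) (Z Infinity)
  texp texp_mul.

End ZSeries.

Lemma leibniz_opp (A : comNzRingType) (D : {additive A -> A}) :
  leibniz D -> leibniz (\- D).
Proof. by move=> DM f g; rewrite /= DM opprD mulNr mulrN. Qed.

Section CommutingFlows.
Variables (A : comNzRingType) (tfA : torsion_free A).
Variables (D D' : nat -> {additive A -> A}).
Variables (phi psi : {additive A -> ps A}).
Hypothesis DC : forall k l f, D k (D' l f) = D' l (D k f).
Hypothesis phi_flow : is_flow D phi.
Hypothesis psi_flow : is_flow D' psi.

Definition flow_coef m (f : A) : A := psi f m.
Let flow_coef_additive m : additive (flow_coef m).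
Proof. by move=> f g; rewrite /flow_coef raddfB. Qed.
HB.instance Definition _ m :=
  GRing.isAdditive.Build A A (flow_coef m) (flow_coef_additive m).

(** The coefficients of one flow commute with the generators of the other, so [flow_commute] applies
    to them. *)
Lemma flowC f m n : phi (psi f m) n = psi (phi f n) m.
Proof.
have DT k g : D k (flow_coef m g) = flow_coef m (D k g).
  by rewrite /flow_coef (flow_commute tfA psi_flow) // => l h; rewrite DC.
exact: (congr1 (@^~ n) (flow_commute tfA phi_flow f DT)).
Qed.

End CommutingFlows.

(** * Shifts acting on wave functions *)

Section TodaFlows.
Variables (R : realType) (N : nat).
Local Notation C := R[i].
Local Notation V := (tvar N).
Local Notation Z := (zseries R N Infinity).
Local Notation T := (tseries R N).
Local Notation letter := (bool * 'I_N)%type.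
Local Notation site := 'rV[int]_N.
Local Notation zp := (@zpow R N Infinity).
Implicit Types (i j : letter).

Definition time_deriv (K : comNzRingType) i k : {additive fps V K -> fps V K} :=
  fps_deriv ((i.1, i.2, k) : V).

Lemma T_torsion_free : torsion_free T.
Proof. exact: divisible_torsion_free (fps_divisible V (C_divisible R)). Qed.

Lemma Z_torsion_free : torsion_free Z.
Proof.
exact: divisible_torsion_free (fps_divisible V (laurent_divisible R Infinity)).
Qed.

Definition tminus i : T -> ps T := flow (fun k => \- (time_deriv C i k)).
Definition tplus i : T -> ps T := flow (time_deriv C i).
Definition zminus i : Z -> ps Z :=
  flow (fun k => \- (time_deriv (laurent C Infinity) i k)).

Lemma tminus_flow i : is_flow (fun k => \- (time_deriv C i k)) (tminus i).
Proof. by apply: flow_is_flow => n; apply: fps_nat_unit; apply: C_divisible. Qed.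
Lemma tplus_flow i : is_flow (time_deriv C i) (tplus i).
Proof. by apply: flow_is_flow => n; apply: fps_nat_unit; apply: C_divisible. Qed.
Lemma zminus_flow i :
  is_flow (fun k => \- (time_deriv (laurent C Infinity) i k)) (zminus i).
Proof.
by apply: flow_is_flow => n; apply: fps_nat_unit; apply: laurent_divisible.
Qed.

Let leib (K : comNzRingType) i k : leibniz (\- (time_deriv K i k)).
Proof. by apply: leibniz_opp; apply: fps_deriv_leibniz. Qed.

HB.instance Definition _ i := GRing.isAdditive.Build T (ps T) (tminus i)
  (flow_additive T_torsion_free (tminus_flow i)).
HB.instance Definition _ i := GRing.isMonoidMorphism.Build T (ps T) (tminus i)
  (flow_mul T_torsion_free (tminus_flow i) (@leib C i)).
HB.instance Definition _ i := GRing.isAdditive.Build T (ps T) (tplus i)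
  (flow_additive T_torsion_free (tplus_flow i)).
HB.instance Definition _ i := GRing.isMonoidMorphism.Build T (ps T) (tplus i)
  (flow_mul T_torsion_free (tplus_flow i) (fun k => fps_deriv_leibniz _)).
HB.instance Definition _ i := GRing.isAdditive.Build Z (ps Z) (zminus i)
  (flow_additive Z_torsion_free (zminus_flow i)).
HB.instance Definition _ i := GRing.isMonoidMorphism.Build Z (ps Z) (zminus i)
  (flow_mul Z_torsion_free (zminus_flow i) (@leib (laurent C Infinity) i)).

Lemma time_derivC (K : comNzRingType) i j k l f :
  time_deriv K i k (time_deriv K j l f) = time_deriv K j l (time_deriv K i k f).
Proof. exact: fps_derivC. Qed.

Lemma tminusC i j f m n : tminus i (tminus j f m) n = tminus j (tminus i f n) m.
Proof.
apply: (flowC T_torsion_free _ (tminus_flow i) (tminus_flow j)) => k l g /=.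
rewrite -[LHS]/(- time_deriv C i k (- time_deriv C j l g)).
rewrite -[RHS]/(- time_deriv C j l (- time_deriv C i k g)).
by rewrite (raddfN (time_deriv C i k)) (raddfN (time_deriv C j l)) time_derivC.
Qed.

Lemma zminus0 i f : zminus i f 0%N = f.
Proof. by have [-> _] := zminus_flow i. Qed.

Lemma zminus_zpow i n : zminus i (zp n) = psC (zp n).
Proof.
apply: (flow_const Z_torsion_free (zminus_flow i)) => k /=.
by rewrite /time_deriv /zpow fps_deriv_const oppr0.
Qed.

Lemma zminus_texp i (w : ps T) n :
  zminus i (texp w) n =
  texp (fun k => tminus i (w k) n).
Proof.
have [tm0 tmD] := tminus_flow i; have [zm0 zmD] := zminus_flow i.
pose h : ps Z := fun n => texp (fun k => tminus i (w k) n).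
suff -> : zminus i (texp w) = h by [].
apply: (flow_uniq Z_torsion_free (zmD _)); last first.
  rewrite zm0 /h; congr texp; apply/funext => k; exact/esym/tm0.
apply: psP => {}n; rewrite dserE /psderiv /h.
transitivity (texp
    (\sum_(k < n.+1) (fun l => - time_deriv C i k (tminus i (w l) (n - k)%N)) : ps T)).
  rewrite -raddfMn; congr texp; apply: psP => l.
  rewrite ps_sumE ps_mulrnE -[LHS]/(psderiv (tminus i (w l)) n) tmD.
  by rewrite dserE.
rewrite raddf_sum; apply: eq_bigr => k _ /=.
apply: fpsP => m; apply/laurentP => l; rewrite texpE /fps_deriv fpsNE laurentNE.
rewrite laurent_mulrnE texpE.
by case: l => [[|l]|l]; rewrite ?mul0rn ?oppr0.
Qed.

(** The shift multiplies e^-xi by the geometric series 1 / (1 - p z): the n + 1 terms of coefficient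
    n in the flow equation all equal z^(n+1) e^-xi. *)
Lemma zminus_exp i j n : zminus i (fps_exp (- xi R Infinity j.1 j.2 1)) n =
  if (j == i) || (n == 0%N) then zp n%:Z * fps_exp (- xi R Infinity j.1 j.2 1)
  else 0.
Proof.
have [zm0 zmD] := zminus_flow i.
set e := fps_exp _.
have De k : time_deriv (laurent C Infinity) i k e =
    (if j == i then - zp k.+1%:Z else 0) * e.
  rewrite /time_deriv /= fps_deriv_fps_exp ?fpsNE ?xi0 ?oppr0 //.
    rewrite raddfN /= fps_deriv_xi -!surjective_pairing [i == j]eq_sym mul1r.
    by case: ifP; rewrite ?oppr0.
  exact: laurent_divisible.
have [ji|ji] /= := boolP (j == i); last first.
  rewrite (flow_const Z_torsion_free (zminus_flow i)) => [|k].
    by case: n => //=; rewrite zpow0 mul1r.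
  by rewrite /= De (negPf ji) mul0r oppr0.
pose h : ps Z := fun n => zp n%:Z * e.
suff -> : zminus i e = h by [].
apply: (flow_uniq Z_torsion_free (zmD _)); last first.
  by rewrite zm0 /h zpow0 mul1r.
apply: psP => k; rewrite dserE /psderiv /h.
rewrite (eq_bigr (fun=> zp k.+1%:Z * e)); first by rewrite sumr_const card_ord.
move=> l _ /=; rewrite fps_deriv_leibniz /zpow fps_deriv_const mul0r add0r.
rewrite -/(zpow _ _ _) De ji mulNr mulrN opprK mulrA -zpowD.
have -> : (k - l)%N%:Z + l.+1%:Z = k.+1%:Z by have := ltn_ord l; lia.
by rewrite /zpow.
Qed.

Lemma zminus_wave i j (c : int) (w : ps T) n :
  zminus i (zp c * fps_exp (- xi R Infinity j.1 j.2 1) * texp w) n =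
  \sum_(r < n.+1 | (j == i) || (r == 0%N :> nat))
    zp (c + r%:Z) * fps_exp (- xi R Infinity j.1 j.2 1) *
    texp (fun k => tminus i (w k) (n - r)%N).
Proof.
rewrite !rmorphM /= zminus_zpow -mulrA psCM psME mulr_sumr [RHS]big_mkcond.
apply: eq_bigr => r _; rewrite zminus_exp zminus_texp.
by case: ifP => _; rewrite ?mul0r ?mulr0 // zpowD !mulrA.
Qed.

End TodaFlows.

(** * From wave functions to power series in z^-1 *)

Section Master.
Local Open Scope mset_scope.
Variables (R : realType) (N : nat).
Local Notation C := R[i].
Local Notation L := (laurent C Infinity).
Local Notation V := (tvar N).
Local Notation Z := (zseries R N Infinity).
Local Notation T := (tseries R N).
Local Notation letter := (bool * 'I_N)%type.
Local Notation site := 'rV[int]_N.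
Local Notation zp := (@zpow R N Infinity).
Implicit Types (i j : letter) (s : site) (a b g : 'I_N) (m : {mset V}).

(** At a fixed unprimed monomial the bilinear identity is a linear relation valid at every primed
    monomial. Derivatives only move and rescale coefficients, so the relation passes to every
    coefficient of the shifted series. *)
Lemma zminus_pairing (wv : letter -> L) (G : letter -> Z) (p q : int) :
  let pairing (X : letter -> L) : C :=
    \sum_g (wv (false, g) * X (false, g)) p
    - \sum_g (wv (true, g) * X (true, g)) q in
  (forall m, pairing (fun l => G l m) = 0) ->
  forall i n m, pairing (fun l => zminus i (G l) n m) = 0.
Proof.
move=> pairing G0 i n.
have P_sum K (X : 'I_K -> letter -> L) :
    pairing (fun l => \sum_k X k l) = \sum_k pairing (X k).
  rewrite /pairing sumrB; congr (_ - _); rewrite exchange_big;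
  by apply: eq_bigr => g _; rewrite mulr_sumr laurent_sumE.
have P_muln X k : pairing (fun l => X l *+ k) = pairing X *+ k.
  rewrite /pairing mulrnBl -!sumrMnl; congr (_ - _);
  by apply: eq_bigr => g _; rewrite mulrnAr laurent_mulrnE.
have P_opp X : pairing (fun l => - X l) = - pairing X.
  rewrite /pairing opprD -!sumrN; congr (_ + _);
  by apply: eq_bigr => g _; rewrite mulrN laurentNE.
elim/ltn_ind: n => -[_ m|n IHn m].
  have -> : (fun l => zminus i (G l) 0%N m) = (fun l => G l m).
    by apply/funext => l; rewrite zminus0.
  exact: G0.
apply: (divisible_torsion_free (C_divisible R) (n := n)).
rewrite -P_muln.
have -> : (fun l => zminus i (G l) n.+1 m *+ n.+1) = (fun l =>
    \sum_(k < n.+1) - (zminus i (G l) (n - k)%N ((i.1, i.2, k : nat) +` m)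
                       *+ (m (i.1, i.2, k : nat)).+1)).
  apply/funext => l; have [_ zmD] := @zminus_flow R N i.
  rewrite -fps_mulrnE -[_ *+ _]/(psderiv (zminus i (G l)) n) zmD dserE.
  by rewrite fps_sumE; apply: eq_bigr => k _.
rewrite P_sum big1 // => k _; rewrite P_opp P_muln.
by rewrite IHn ?mul0rn ?oppr0 // ltnS leq_subr.
Qed.

Variables (W : site -> 'I_N -> letter -> ps T).
Variables (W' : site -> letter -> 'I_N -> ps T).

Definition wsign i (x : int) : int := if i.1 then - x else x.

Definition wave s a i : Z :=
  zp (wsign i (s 0 i.2)) * fps_exp (xi R Infinity i.1 i.2 1) *
  texp (W s a i).

Definition wave_adj s i b : Z :=
  zp (- wsign i (s 0 i.2)) * fps_exp (- xi R Infinity i.1 i.2 1) *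
  texp (W' s i b).

Hypothesis wave_bilinear : forall a b s s' m m',
  \sum_g (wave s a (false, g) m * wave_adj s' (false, g) b m') (- 1) =
  \sum_g (wave s a (true, g) m * wave_adj s' (true, g) b m') 1.

(** The factor z^-2 on the barred side turns its residue into the coefficient of z. *)
Let wpoint i : int := if i.1 then 1 else - 1.

Let texp_coefz (h : ps T) m k :
  texp h m (- k) = coefz h k m.
Proof. by rewrite texpE; case: k => [[|k]|k]. Qed.

Lemma wave_residue i0 j0 s s' a b n k i m :
  (wave s a i * zminus i0 (zminus j0 (wave_adj s' i b) k) n) m (wpoint i) =
  bres (@tminus R N) W W' true i0 j0 s s' a b i k n m.
Proof.
have term c w : (wave s a i *
    (zp (- wsign i (s' 0 i.2) + c) * fps_exp (- xi R Infinity i.1 i.2 1) *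
     texp w)) m (wpoint i) =
    coefz (W s a i * w) (bexp i s s' + c) m.
  rewrite -texp_coefz.
  rewrite rmorphM /wave /=; set e := fps_exp _.
  (* Both functions now depend on the same times, so the exponentials cancel and a coefficient of a
     series in z^-1 remains. *)
  have ee : e * fps_exp (- xi R Infinity i.1 i.2 1) = 1.
    by apply: fps_expN; [exact: laurent_divisible | exact: xi0].
  rewrite mulrACA [X in X * _]mulrACA ee mulr1 -zpowD zpowME.
  congr (_ _ _); rewrite /wpoint /wsign /bexp.
  by case: i.1; lia.
rewrite zminus_wave raddf_sum /= ps_sumE.
under eq_bigr do rewrite zminus_wave.
rewrite mulr_sumr fps_sumE laurent_sumE.
under eq_bigr do rewrite mulr_sumr fps_sumE laurent_sumE.
rewrite /bres /residue2 exchange_big /= fps_sumE; apply: eq_bigr => r _.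
rewrite fps_sumE; apply: eq_bigr => r' _.
by rewrite -addrA term [(r' : nat)%:Z + _]addrC.
Qed.

Lemma master_identity i0 j0 s s' a b :
  \sum_g bres (@tminus R N) W W' true i0 j0 s s' a b (false, g) =
  \sum_g bres (@tminus R N) W W' true i0 j0 s s' a b (true, g).
Proof.
apply: psP => k; apply: psP => n; apply: fpsP => m.
rewrite !ps_sumE !fps_sumE.
under eq_bigr do rewrite -wave_residue.
under [RHS]eq_bigr do rewrite -wave_residue.
rewrite /wpoint /=; under eq_bigr do rewrite fpsME laurent_sumE.
under [RHS]eq_bigr do rewrite fpsME laurent_sumE.
rewrite exchange_big [RHS]exchange_big; apply: eq_bigr => -[m1 m2] _ /=.
apply/eqP; rewrite -subr_eq0; apply/eqP.
apply: (@zminus_pairing (fun l => wave s a l m1)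
  (fun l => zminus j0 (wave_adj s' l b) k) (- 1) 1) => m3.
apply: (@zminus_pairing (fun l => wave s a l m1)
  (fun l => wave_adj s' l b) (- 1) 1) => m4.
by rewrite wave_bilinear subrr.
Qed.

End Master.

(** * The substitution of z^-1 for z, and shifts as flows *)

Section SubstInverse.
Local Open Scope mset_scope.
Variables (R : realType) (N : nat).
Local Notation C := R[i].
Local Notation V := (tvar N).
Local Notation Z := (zseries R N).
Local Notation T := (tseries R N).
Local Notation letter := (bool * 'I_N)%type.

Lemma laurent_zVE (f : laurent C Zero) n : laurent_zV f n = f (- n).
Proof. by []. Qed.

Let zV_additive : additive (@zV R N).
Proof.
move=> f g; apply: fpsP => m; apply/laurentP => n.
by rewrite fpsDE fpsNE laurentDE laurentNE /zV !laurent_zVE fpsDE fpsNE.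
Qed.
HB.instance Definition _ := GRing.isAdditive.Build (Z Zero) (Z Infinity)
  (@zV R N) zV_additive.

Let laurent_zVM (f g : laurent C Zero) :
  laurent_zV (f * g) = laurent_zV f * laurent_zV g.
Proof.
apply/laurentP => n; rewrite laurent_zVE.
rewrite -[LHS]/(conv +%R f g (- n)) -[RHS]/(conv +%R (laurent_zV f) (laurent_zV g) n).
rewrite /conv (reindex_fsbig (fun p => (- p.1, - p.2))
  [set p : int * int | p.1 + p.2 = n]%classic) //.
split=> //=.
- by move=> [x y] /= <-; rewrite opprD.
- by move=> [x y] [x' y'] _ _ [/oppr_inj -> /oppr_inj ->].
by move=> [x y] /= xy; exists (- x, - y); rewrite /= ?opprK // -opprD xy opprK.
Qed.

Let zV_mul : monoid_morphism (@zV R N).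
Proof.
split=> [|f g]; apply: fpsP => m; apply/laurentP => n.
  rewrite !fps_oneE /zV laurent_zVE /fps_const.
  by case: eqP => _ //=; rewrite oppr_eq0.
rewrite /zV laurent_zVE !fpsME !laurent_sumE; apply: eq_bigr => p _.
by rewrite -laurent_zVE laurent_zVM.
Qed.
HB.instance Definition _ := GRing.isMonoidMorphism.Build (Z Zero) (Z Infinity)
  (@zV R N) zV_mul.

Lemma zV_zpow n : zV (@zpow R N Zero n) = zpow R Infinity (- n).
Proof.
apply: fpsP => m; apply/laurentP => k; rewrite /zV laurent_zVE /zpow /fps_const.
by case: eqP => _ /=; rewrite ?eqr_oppLR ?if_same.
Qed.

Lemma zV_xi bar a e : zV (@xi R N Zero bar a e) = xi R Infinity bar a (- e).
Proof.
apply: fpsP => m; apply/laurentP => k; rewrite /zV laurent_zVE /xi /fps_linear.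
case: (m : seq V) => [|[[b' a'] j] [|u s]] //=; rewrite ?if_same //.
by case: ifP => _ /=; rewrite ?if_same // mulNr eqr_oppLR.
Qed.

Lemma zV_expansion (w : ps T) : zV (expansion Zero w) = texp w.
Proof.
apply: fpsP => m; apply/laurentP => k; rewrite texpE /zV laurent_zVE /=.
by case: k => [[|k]|k].
Qed.

Lemma zV_fps_exp (f : Z Zero) : zV (fps_exp f) = fps_exp (zV f).
Proof.
apply: fpsP => m; rewrite /fps_exp.
rewrite -[LHS]/(zV (\sum_(n < (size m).+1) f ^+ n / n`!%:R) m) rmorph_sum.
congr (_ m); apply: eq_bigr => n _.
rewrite rmorphM rmorphXn rmorphV /= ?rmorph_nat //.
exact: fps_fact_unit (laurent_divisible R Zero) _.
Qed.

Lemma texp_psC (f : T) : texp (psC f) = of_tseries Infinity f.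
Proof.
apply: fpsP => m; apply/laurentP => n; rewrite texpE /of_tseries /=.
by case: n => [[|k]|k].
Qed.

Lemma texp_psX : texp psX = @zpow R N Infinity (- 1).
Proof.
apply: fpsP => m; apply/laurentP => n; rewrite texpE /zpow /fps_const /psX.
have one k : ((k == 1%N)%:R : T) m = if m == mset0 then (k == 1%N)%:R else 0.
  by case: (k == 1%N); [rewrite -[LHS]/((1 : T) m) (@fps_oneE V C) | rewrite if_same].
case: n => [[|k]|[|k]]; rewrite ?one; case: eqP => //= _.
Qed.

(** By [shift_coef_rec] the binomial shift solves the flow equation, and uniqueness identifies the
    two. *)
Lemma shift_flow (eps : C) (D : nat -> {additive T -> T}) (phi : T -> ps T)
    bar (a : 'I_N) f :
  (forall k g m, D k g m = eps * fps_deriv ((bar, a, k) : V) g m) ->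
  is_flow D phi -> shift eps bar a f = texp (phi f).
Proof.
move=> DE [phi0 phiD].
pose h : ps T := fun n m => shift_coef eps bar a f m (- n%:Z).
have -> : phi f = h.
  apply: (flow_uniq (@T_torsion_free R N) (phiD f)); last first.
    apply: fpsP => m; rewrite phi0 /h shift_coefE.
    rewrite (_ : ppart bar a 0 = [fset mset0]%fset).
      rewrite big_seq_fset1 msetD0 /mbinom /miwa_coef enum_mset0 !big_nil.
      by rewrite mulr1.
    apply/fsetP => k; rewrite in_ppart in_fset1.
    apply/andP/eqP => [[_]|->]; last by rewrite /pure /weight enum_mset0 big_nil.
    have [-> //|[v [k' ->]]] := mset_case k.
    rewrite /weight (big_rem v) ?addn_eq0 //.
    by rewrite -has_pred1 has_count count_mem_mset mset1DE eqxx.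
  apply: psP => n; apply: fpsP => m.
  rewrite dserE fps_sumE /psderiv fps_mulrnE /h shift_coef_rec.
  by apply: eq_bigr => k _; rewrite DE.
apply: fpsP => m; apply/laurentP => n; rewrite texpE /h.
rewrite -[LHS]/(shift_coef eps bar a f m n).
case: n => [[|k]|k]; rewrite ?NegzE ?abszN //.
apply: fsbig1 => l _; apply/eqP; apply: contraT => /shift_term_neq0 [_ kE].
suff : k.+1%:Z <= 0 by [].
by rewrite kE oppr_le0 sumr_ge0.
Qed.

End SubstInverse.

(** * The tau function *)

Section TauFunction.
Variables (R : realType) (N : nat).
Local Notation C := R[i].
Local Notation V := (tvar N).
Local Notation T := (tseries R N).
Local Notation letter := (bool * 'I_N)%type.
Local Notation site := 'rV[int]_N.
Implicit Types (i j : letter) (s : site) (a b g : 'I_N).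

Variables (W : site -> 'I_N -> letter -> ps T).
Variables (W' : site -> letter -> 'I_N -> ps T).
Hypothesis W0 : forall s a g, W s a (false, g) 0%N = (a == g)%:R.
Hypothesis W'0 : forall s a g, W' s (false, g) a 0%N = (g == a)%:R.
Let d := @time_deriv N C.
Variable phi : letter -> {rmorphism T -> ps T}.
Hypothesis phi_flow : forall i, is_flow (fun k => \- (d i k)) (phi i).
Hypothesis phiC : forall i j f m n,
  phi i (phi j f m) n = phi j (phi i f n) m.
Hypothesis master : forall i0 j0 s s' a b,
  \sum_g bres phi W W' true i0 j0 s s' a b (false, g) =
  \sum_g bres phi W W' true i0 j0 s s' a b (true, g).

Let u i s : ps T := W s i.2 i.
Let v i s : ps T := hat phi i (W' (s + estep i) i i.2).
Let phi0 i f : phi i f 0%N = f. Proof. by have [-> _] := phi_flow i. Qed.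

Let uv i s : u i s * v i s = 1.
Proof. exact: (W_inv phi0 phiC W0 W'0 master). Qed.

Let cocycle i j s :
  psC (u i s) * psmap (phi i) (u j (s + estep i)) =
  psmap (@psC T) (u j s) * shift2 phi j (u i (s + estep j)).
Proof. exact: (fay_cocycle phi0 phiC W0 W'0 master). Qed.

Let cocycle0 i j s :
  u i s 0%N * u j (s + estep i) 0%N = u j s 0%N * u i (s + estep j) 0%N.
Proof.
have ps00 (F G : ps (ps T)) : (F * G) 0%N 0%N = F 0%N 0%N * G 0%N 0%N.
  by rewrite psM0 psM0.
have := congr1 (fun F : ps (ps T) => F 0%N 0%N) (cocycle i j s).
rewrite ps00 ps00 -[psmap (phi i) _ 0%N 0%N]/(phi i (u j (s + estep i) 0%N) 0%N).
rewrite -[shift2 _ _ _ 0%N 0%N]/(phi j (u i (s + estep j) 0%N) 0%N).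
by rewrite !phi0.
Qed.

Let dM i k : leibniz (d i k). Proof. exact: fps_deriv_leibniz. Qed.
Let tfT := @T_torsion_free R N.

Let g i k s : T := dlog_tau d u v i k s.

(** tau(s) = c(s) exp F, where F integrates the closed form g at s = 0 and c, with c(0) = 1, carries
    the dependence on s; the derivative of log c(s) is then g(s) - g(0). *)
Lemma tau_exists : exists tau : site -> T,
  (forall s, tau s \is a GRing.unit) /\
  forall i s, phi i (tau (s + estep i)) = u i s * psC (tau s).
Proof.
have uv0 i s : u i s 0%N * v i s 0%N = 1 by rewrite -psM0 uv.
have uU i s : u i s 0%N \is a GRing.unit.
  by apply/unitrP; exists (v i s 0%N); rewrite mulrC uv0.
have step (i : letter) b k s := dlog_tau_step tfT dM (@time_derivC N C)
  phi_flow uv cocycle i (true, b) k s.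
have [||c [c0 cU cS]] := @lattice_potential N T (fun b s => u (true, b) s 0%N).
- by move=> b s; apply: uU.
- by move=> b b' s; apply: (cocycle0 (true, b) (true, b') s).
pose gt (w : V) : T := g (w.1.1, w.1.2) w.2 0.
have [F [F0 FD]] : exists F : T, F mset0 = 0 /\ forall w, fps_deriv w F = gt w.
  apply: (fps_poincare (C_divisible R)) => -[[b a] k] [[b' a'] k'].
  exact: (dlog_tau_closed tfT dM (@time_derivC N C) phi_flow uv cocycle
    (b', a') (b, a) k' k 0).
pose tau0 : T := fps_exp F.
have tau0D i k : d i k tau0 = g i k 0 * tau0.
  rewrite /d /time_deriv /= /tau0 (fps_deriv_fps_exp (C_divisible R)) // FD.
  by rewrite /gt /= -surjective_pairing.
have tau0U : tau0 \is a GRing.unit.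
  have E : tau0 * fps_exp (- F) = 1 := fps_expN (C_divisible R) F0.
  by apply/unitrP; exists (fps_exp (- F)); exact: conj (etrans (mulrC _ _) E) E.
(* By [dlog_tau_step] both sides change alike along a lattice step; u being a unit, the step is
   reversible, as [lattice_ind] demands. *)
have cD s : forall i k, d i k (c s) = (g i k s - g i k 0) * c s.
  elim/lattice_ind: s => [i k | s b].
    rewrite subrr mul0r c0; exact: (fps_deriv_nat C _ 1).
  have stepE i k : (d i k (c (s + delta_mx 0 b)) =
      (g i k (s + delta_mx 0 b) - g i k 0) * c (s + delta_mx 0 b)) <->
      (d i k (c s) = (g i k s - g i k 0) * c s).
    set f := u (true, b) s 0%N; have fU : f \is a GRing.unit := uU _ _.
    have gE : g i k (s + delta_mx 0 b) = g i k s + d i k f * v (true, b) s 0%N.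
      exact: step.
    rewrite cS -/f dM gE.
    have -> : (g i k s + d i k f * v (true, b) s 0%N - g i k 0) * (f * c s) =
        d i k f * c s + f * ((g i k s - g i k 0) * c s).
      have := uv0 (true, b) s; rewrite -/f => fv.
      rewrite -[d i k f * c s in RHS]mul1r -fv; ring.
    by split=> [/addrI/(mulrI fU) | ->].
  by split=> H i k; apply/stepE.
exists (fun s => c s * tau0); split=> [s|]; first by rewrite unitrM cU.
apply: (tau_shift tfT dM phi_flow uv).
  by move=> i k s; rewrite dM cD tau0D -/(g i k s); ring.
(* Unbarred letters leave s fixed, and their u has constant term 1. *)
move=> [[] b] s; first by rewrite cS mulrA.
by rewrite /estep addr0 /u W0 eqxx mul1r.
Qed.

Variable psi : letter -> {rmorphism T -> ps T}.
Hypothesis psi_phi : forall i f, diag (psmap (psi i) (phi i f)) = psC f.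
Variable tau : site -> T.
Hypothesis tau_phi : forall i s,
  phi i (tau (s + estep i)) = u i s * psC (tau s).

(** The off-diagonal entry is read off from the coefficient of z^-1 in the formula for Psi_ab, where
    the shift is still trivial. *)
Definition tau_mx s : 'M[T]_N :=
  \matrix_(a, b) if a == b then tau s else tau s * W s a (false, b) 1%N.

Lemma W_tau i s a :
  W s a i * psC (tau s) =
  (if a == i.2 then 1 else cvar T i) * phi i (tau_mx (s + estep i) a i.2).
Proof.
rewrite mxE; have [->|ai] := eqVneq a i.2; first by rewrite mul1r tau_phi.
rewrite rmorphM tau_phi (W_off phi0 phiC W0 W'0 master s ai).
by rewrite -/(u i s); ring.
Qed.

(** The adjoint formulas shift the other way, so the shift inside [hat] is undone by the inverse
    flow; by [diag_diag] the variables of the two shifts may be identified first, where they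
    cancel. *)
Lemma hat_inverse i h : diag (psmap (psi i) (hat phi i h)) = h.
Proof.
rewrite /hat -diag_psmap_psmap diag_diag.
rewrite -[RHS]diag_psmapC; congr diag; apply: psP => k; exact: psi_phi.
Qed.

Let W'_tau_step i s b :
  psC (tau (s + estep i)) * W' (s + estep i) i b =
  (if i.2 == b then 1 else - cvar T i) * psi i (tau_mx s i.2 b).
Proof.
have hatM f h : phi i f * hat phi i h = hat phi i (psC f * h).
  by rewrite /hat rmorphM /= psmapC rmorphM /= diagC.
have psiC f : diag (psmap (psi i) (psC f)) = psi i f by rewrite psmapC diagC.
(* By [tau_phi] the shifted tau brings in u_i, which combines with the shifted adjoint function
   through [uv] or [W'_off]. *)
rewrite -[LHS](hat_inverse i) -hatM tau_phi mulrAC mxE eq_sym.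
have [->|bi] := eqVneq b i.2.
  by rewrite (uv i s) !mul1r psiC.
have psiM c f : diag (psmap (psi i) (c * psC f)) =
    diag (psmap (psi i) c) * psi i f.
  by rewrite (rmorphM (psmap (psi i))) (rmorphM (@diag T)) /= psiC.
rewrite (W'_off phi0 phiC W0 W'0 master s bi).
have -> : - (cvar T i * psC (W s i.2 (false, b) 1%N)) * psC (tau s) =
    - cvar T i * psC (tau s * W s i.2 (false, b) 1%N) by rewrite rmorphM; ring.
have cE : diag (psmap (psi i) (- cvar T i)) = - cvar T i.
  rewrite /cvar; case: i.1; rewrite ?opprK ?rmorph1 //.
  by rewrite !rmorphN /= psmapX diagX.
by rewrite psiM cE.
Qed.

Lemma W'_tau i s b :
  psC (tau s) * W' s i b =
  (if i.2 == b then 1 else - cvar T i) * psi i (tau_mx (s - estep i) i.2 b).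
Proof. by rewrite -W'_tau_step subrK. Qed.

End TauFunction.

(** * Prefactors and translation back to wave functions *)

Section Conclusion.
Variables (R : realType) (N : nat).
Local Notation C := R[i].
Local Notation T := (tseries R N).
Local Notation Z := (zseries R N Infinity).
Local Notation letter := (bool * 'I_N)%type.

Lemma contour_int_inj (f g : laurent C Infinity) :
  contour_int f = contour_int g -> f (- 1) = g (- 1).
Proof.
apply: mulfI; rewrite eq_complex /= negb_and; apply/orP; right.
by rewrite mulf_neq0 ?pnatr_eq0 // gt_eqF // pi_gt0.
Qed.

Lemma contour_int_sum I (r : seq I) (F : I -> laurent C Infinity) :
  \sum_(k <- r) contour_int (F k) = contour_int (\sum_(k <- r) F k).
Proof. by rewrite /contour_int laurent_sumE mulr_sumr. Qed.

Lemma texp_mulK (w h : ps T) (t : T) : t \is a GRing.unit ->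
  w * psC t = h -> texp w = texp h / of_tseries Infinity t.
Proof.
move=> tU <-; rewrite rmorphM /= texp_psC mulrK //.
rewrite -texp_psC; apply/unitrP; exists (texp (psC t^-1)).
by rewrite -!rmorphM /= mulVr // mulrV // !rmorph1.
Qed.

Lemma shift_minus (i : letter) (f : T) : shift (- 1) i.1 i.2 f = texp (tminus i f).
Proof.
apply: (@shift_flow R N (- 1) (fun k => \- (time_deriv C i k)) _ i.1 i.2 f _
  (@tminus_flow R N i)) => k g m.
by rewrite mulN1r.
Qed.

Lemma shift_plus (i : letter) (f : T) : shift 1 i.1 i.2 f = texp (tplus i f).
Proof.
apply: (@shift_flow R N 1 (time_deriv C i) _ i.1 i.2 f _ (@tplus_flow R N i)) => k g m.
by rewrite mul1r.
Qed.

Lemma tplus_tminus (i : letter) (f : T) : diag (psmap (tplus i) (tminus i f)) = psC f.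
Proof.
apply: (flow_inverse (@T_torsion_free R N) _ (@tminus_flow R N i)
  (@tplus_flow R N i)).
by move=> k l g; exact: time_derivC.
Qed.

Let zp := @zpow R N Infinity.

(** This and the next lemmas turn [cvar] into the prefactors of the theorem; for the barred adjoint
    function the two signs cancel. *)
Lemma texp_cvar_false (b : bool) (g : 'I_N) :
  texp (if b then 1 else cvar T (false, g)) = zp (b%:Z - 1).
Proof. by case: b; rewrite ?rmorph1 ?subrr ?/zp ?zpow0 // texp_psX. Qed.

Lemma sign_cases (b : bool) : (- 1) ^ (b%:Z - 1) = if b then 1 else - 1 :> Z.
Proof. by case: b; rewrite ?subrr ?expr0z // exprN1 invrN1. Qed.

Lemma texp_cvarN_false (b : bool) (g : 'I_N) :
  texp (if b then 1 else - cvar T (false, g)) = (- 1) ^ (b%:Z - 1) * zp (b%:Z - 1).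
Proof.
rewrite sign_cases -(texp_cvar_false b g); case: b; first by rewrite mul1r.
by rewrite rmorphN mulN1r.
Qed.

Lemma texp_cvar_true (b : bool) (g : 'I_N) :
  texp (if b then 1 else cvar T (true, g)) = (- 1) ^ (b%:Z - 1).
Proof. by rewrite sign_cases; case: b; rewrite ?rmorph1 // rmorphN rmorph1. Qed.

Lemma texp_cvarN_true (b : bool) (g : 'I_N) :
  texp (if b then 1 else - cvar T (true, g)) = 1.
Proof. by case: b; rewrite ?opprK rmorph1. Qed.

End Conclusion.

Theorem theorem5p1 (R : realType) (N : nat) (hN : (0 < N)%N)
    (Psi Psi' : 'rV[int]_N -> 'M[zseries R N Infinity]_N)
    (bPsi bPsi' : 'rV[int]_N -> 'M[zseries R N Zero]_N)
    (hPsi : Psi_form Psi) (hPsi' : Psi_adj_form Psi')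
    (hbPsi : barPsi_form bPsi) (hbPsi' : barPsi_adj_form bPsi')
    (hbil : bilinear_identity Psi Psi' bPsi bPsi') :
  exists (tau_ : 'rV[int]_N -> 'M[tseries R N]_N)
         (tau : 'rV[int]_N -> tseries R N),
    [/\ forall s a, tau_ s a a = tau s,
        forall s, tau s \is a GRing.unit &
        forall (s : 'rV[int]_N) (a b : 'I_N),
        [/\ Psi s a b =
              zpow R Infinity (s 0 b + (a == b)%:Z - 1)
              * fps_exp (xi R Infinity false b 1)
              * (shift (- 1) false b (tau_ s a b)
                 / of_tseries Infinity (tau s)),
            Psi' s a b =
              (- 1) ^ ((a == b)%:Z - 1)
              * zpow R Infinity (- s 0 a + (a == b)%:Z - 1)
              * fps_exp (- xi R Infinity false a 1)
              * (shift 1 false a (tau_ s a b)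
                 / of_tseries Infinity (tau s)),
            zV (bPsi s a b) =
              (- 1) ^ ((a == b)%:Z - 1)
              * zpow R Infinity (- s 0 b)
              * fps_exp (xi R Infinity true b 1)
              * (shift (- 1) true b (tau_ (s + delta_mx 0 b) a b)
                 / of_tseries Infinity (tau s)) &
            zV (bPsi' s a b) =
              zpow R Infinity (s 0 a)
              * fps_exp (- xi R Infinity true a 1)
              * (shift 1 true a (tau_ (s - delta_mx 0 a) a b)
                 / of_tseries Infinity (tau s))]].
Proof.
have [w [w0 PsiE]] := hPsi; have [w' [w'0 Psi'E]] := hPsi'.
have [bw [_ bPsiE]] := hbPsi; have [bw' [_ bPsi'E]] := hbPsi'.
(* One family for both kinds of letters; for barred ones the same coefficients belong to powers of
   z^-1 after z -> z^-1. *)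
pose W (s : 'rV[int]_N) (a : 'I_N) (l : bool * 'I_N) : ps (tseries R N) :=
  fun j => (if l.1 then bw else w) s j a l.2.
pose W' (s : 'rV[int]_N) (l : bool * 'I_N) (b : 'I_N) : ps (tseries R N) :=
  fun j => (if l.1 then bw' else w') s j l.2 b.
have zVbPsi s a g : zV (bPsi s a g) = wave W s a (true, g).
  rewrite bPsiE !rmorphM /= zV_zpow zV_fps_exp zV_xi opprK zV_expansion.
  by [].
have zVbPsi' s a g : zV (bPsi' s g a) = wave_adj W' s (true, g) a.
  rewrite bPsi'E !rmorphM /= zV_zpow zV_fps_exp rmorphN /= zV_xi zV_expansion.
  by [].
have W0 s a g : W s a (false, g) 0%N = (a == g)%:R by rewrite /W /= w0 mxE.
have W'0 s a g : W' s (false, g) a 0%N = (g == a)%:R by rewrite /W' /= w'0 mxE.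
have bil a b s s' m m' :
    \sum_g (wave W s a (false, g) m * wave_adj W' s' (false, g) b m') (- 1) =
    \sum_g (wave W s a (true, g) m * wave_adj W' s' (true, g) b m') 1.
  have := hbil a b s s' m m'; rewrite !contour_int_sum => /contour_int_inj.
  rewrite !laurent_sumE => E.
  transitivity (\sum_g (Psi s a g m * Psi' s' g b m') (- 1)).
    by apply: eq_bigr => g _; rewrite PsiE Psi'E.
  rewrite E; apply: eq_bigr => g _.
  by rewrite mulrC monomialME mul1r zVbPsi zVbPsi'.
have master := master_identity bil.
have [tau [tauU tau_phi]] := tau_exists W0 W'0 (@tminus_flow R N)
  (@tminusC R N) master.
have Wtau := W_tau W0 W'0 (@tminus_flow R N) (@tminusC R N) master tau_phi.
have W'tau := W'_tau W0 W'0 (@tminus_flow R N) (@tminusC R N) master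
  (@tplus_tminus R N) tau_phi.
have factor s f h c : f * psC (tau s) = c * h ->
    texp f = texp c * (texp h / of_tseries Infinity (tau s)).
  by move=> /(texp_mulK (tauU s)) ->; rewrite rmorphM mulrA.
exists (tau_mx W tau), tau; split=> [s a||s a b]; first by rewrite mxE eqxx.
  exact: tauU.
split.
- rewrite PsiE -[expansion _ _]/(texp (W s a (false, b))).
  rewrite (factor _ _ _ _ (Wtau (false, b) s a)) texp_cvar_false addr0.
  by rewrite (shift_minus (false, b)) -addrA (@zpowD R N _ (s 0 b)) /=; ring.
- rewrite Psi'E -[expansion _ _]/(texp (W' s (false, a) b)).
  have := W'tau (false, a) s b; rewrite mulrC => /factor ->.
  rewrite texp_cvarN_false subr0.
  by rewrite (shift_plus (false, a)) -addrA (@zpowD R N _ (- s 0 a)) /=; ring.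
- rewrite zVbPsi /wave (factor _ _ _ _ (Wtau (true, b) s a)) texp_cvar_true.
  by rewrite (shift_minus (true, b)) /=; ring.
rewrite zVbPsi' /wave_adj; have := W'tau (true, a) s b; rewrite mulrC => /factor ->.
rewrite texp_cvarN_true mul1r (shift_plus (true, a)) /wsign /= opprK.
by [].
Qed.
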